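(* Let $p$ be an odd prime and $\alpha\in\mathbb{Z}_p^\times$. Let $$g_p(\alpha)=\frac{\Gamma_p(1+\frac12\alpha)\Gamma_p(1-\frac32\alpha)}{\Gamma_p(1+\alpha)\Gamma_p(1-\alpha)\Gamma_p(1-\frac12\alpha)^2},\qquad S=\sum_{k=0}^{p-1}\frac{(\alpha)_k^3}{(k!)^3}.$$ Then modulo $p^3$: $S\equiv2g_p(\alpha)$ if $\langle-\alpha\rangle_p$ is even and $\langle-\alpha\rangle_p<\frac23p$; $S\equiv p(2-3\alpha_p^* )g_p(\alpha)$ if $\langle-\alpha\rangle_p$ is even and $\langle-\alpha\rangle_p\geq\frac23p$; $S\equiv p\alpha_p^*g_p(\alpha)$ if $\langle-\alpha\rangle_p$ is odd and $\langle-\alpha\rangle_p<\frac13p$; $S\equiv\frac12p^2\alpha_p^*(1-3\alpha_p^* )g_p(\alpha)$ if $\langle-\alpha\rangle_p$ is odd and $\langle-\alpha\rangle_p\geq\frac13p$.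
   Context: $\mathbb{Z}_p^\times=\{x\in\mathbb{Z}_p:p\nmid x\}$. $(x)_k=x(x+1)\cdots(x+k-1)$ with $(x)_0=1$. $\langle x\rangle_p\in\{0,\ldots,p-1\}$ is the least nonnegative residue of $x\in\mathbb{Z}_p$ mod $p$, and $\alpha_p^*=(\alpha+\langle-\alpha\rangle_p)/p\in\mathbb{Z}_p$. $\Gamma_p$ is Morita's $p$-adic Gamma function: $\Gamma_p(0)=1$, $\Gamma_p(n)=(-1)^n\prod_{1\leq k<n,\ p\nmid k}k$ for integers $n\geq1$, extended continuously to $\mathbb{Z}_p$. *)

(* Defs.v *)
From HB Require Import structures.
From mathcomp Require Import all_boot all_order all_algebra.
From mathcomp Require Import cyclic.
From mathcomp Require Import boolp classical_sets.

Set Implicit Arguments.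
Unset Strict Implicit.
Unset Printing Implicit Defensive.

Import Order.TTheory GRing.Theory Num.Theory.
Local Open Scope ring_scope.

(* Z_p is the inverse limit of the Z / p^n: an element is the sequence of its
   canonical residues modulo p^n, where the case m = n of residueP says
   residue n < p^n.  Primality of p is carried by the type so that the ring
   instances below do not need it as a side condition. *)
Record padic_int (p : nat) (p_pr : prime p) := PadicInt {
  residue : nat -> nat;
  residueP : forall m n, (m <= n)%N -> (residue n %% p ^ m = residue m)%N }.

HB.instance Definition _ (p : nat) (p_pr : prime p) :=
  gen_eqMixin (padic_int p_pr).
HB.instance Definition _ (p : nat) (p_pr : prime p) :=
  gen_choiceMixin (padic_int p_pr).

Lemma residue_mod (p : nat) (p_pr : prime p) (x : padic_int p_pr) (n : nat) :
  (residue x n %% p ^ n = residue x n)%N.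
Proof. exact: residueP. Qed.

Lemma padic_ext (p : nat) (p_pr : prime p) (x y : padic_int p_pr) :
  (forall n, residue x n = residue y n %[mod p ^ n])%N -> x = y.
Proof.
case: x y => [u hu] [v hv] /= uv.
have e : u = v by apply/funext => n; rewrite -(hu n n) // -(hv n n).
by case: _ / e hv uv => hv _; congr PadicInt; exact: Prop_irrelevance.
Qed.

Lemma padic_of_subproof (p : nat) (u : nat -> nat) :
  (forall m n, m <= n -> u n = u m %[mod p ^ m])%N ->
  forall m n, (m <= n)%N -> ((u n %% p ^ n) %% p ^ m = u m %% p ^ m)%N.
Proof. by move=> hu m n mn; rewrite modn_dvdm ?dvdn_exp2l // hu. Qed.

Definition padic_of (p : nat) (p_pr : prime p) (u : nat -> nat)
  (hu : forall m n, (m <= n -> u n = u m %[mod p ^ m])%N) : padic_int p_pr :=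
  PadicInt p_pr (padic_of_subproof hu).

Lemma residue_eqmod (p : nat) (p_pr : prime p) (x : padic_int p_pr) m n :
  (m <= n)%N -> (residue x n = residue x m %[mod p ^ m])%N.
Proof. by move=> mn; rewrite residueP // residue_mod. Qed.

Lemma padic_cst_subproof (p c : nat) m n :
  ((m <= n)%N -> c = c %[mod p ^ m])%N.
Proof. by []. Qed.

Lemma padic_add_subproof (p : nat) (p_pr : prime p) (x y : padic_int p_pr) m n :
  (m <= n ->
   residue x n + residue y n = residue x m + residue y m %[mod p ^ m])%N.
Proof.
by move=> mn; rewrite -modnDm !(residueP _ mn) // -(residue_mod x) -(residue_mod y) modnDm !residue_mod.
Qed.

Lemma padic_mul_subproof (p : nat) (p_pr : prime p) (x y : padic_int p_pr) m n :
  (m <= n ->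
   residue x n * residue y n = residue x m * residue y m %[mod p ^ m])%N.
Proof.
by move=> mn; rewrite -modnMm !(residueP _ mn).
Qed.

Lemma residue_lt (p : nat) (p_pr : prime p) (x : padic_int p_pr) n :
  (residue x n < p ^ n)%N.
Proof. by rewrite -residue_mod ltn_mod expn_gt0 prime_gt0. Qed.

Lemma padic_opp_subproof (p : nat) (p_pr : prime p) (x : padic_int p_pr) m n :
  (m <= n -> p ^ n - residue x n = p ^ m - residue x m %[mod p ^ m])%N.
Proof.
move=> mn; apply/eqP; rewrite -(eqn_modDr (residue x m)).
rewrite (subnK (ltnW (residue_lt x m))) modnn -modnDmr -(residueP x mn).
rewrite modn_mod modnDmr (subnK (ltnW (residue_lt x n))).
by rewrite -(subnKC mn) expnD modnMr.
Qed.

Definition padic_zero (p : nat) (p_pr : prime p) : padic_int p_pr :=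
  padic_of p_pr (@padic_cst_subproof p 0).
Definition padic_one (p : nat) (p_pr : prime p) : padic_int p_pr :=
  padic_of p_pr (@padic_cst_subproof p 1).
Definition padic_add (p : nat) (p_pr : prime p) (x y : padic_int p_pr) :=
  padic_of p_pr (padic_add_subproof x y).
Definition padic_opp (p : nat) (p_pr : prime p) (x : padic_int p_pr) :=
  padic_of p_pr (padic_opp_subproof x).
Definition padic_mul (p : nat) (p_pr : prime p) (x y : padic_int p_pr) :=
  padic_of p_pr (padic_mul_subproof x y).

Lemma padic_addA (p : nat) (p_pr : prime p) : associative (@padic_add p p_pr).
Proof.
by move=> x y z; apply: padic_ext => n /=; rewrite !modn_mod modnDml modnDmr addnA.
Qed.

Lemma padic_addC (p : nat) (p_pr : prime p) : commutative (@padic_add p p_pr).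
Proof. by move=> x y; apply: padic_ext => n /=; rewrite addnC. Qed.

Lemma padic_add0 (p : nat) (p_pr : prime p) :
  left_id (padic_zero p_pr) (@padic_add p p_pr).
Proof.
by move=> x; apply: padic_ext => n /=; rewrite modn_mod modnDml add0n.
Qed.

Lemma padic_addN (p : nat) (p_pr : prime p) :
  left_inverse (padic_zero p_pr) (@padic_opp p p_pr) (@padic_add p p_pr).
Proof.
move=> x; apply: padic_ext => n /=.
by rewrite !modn_mod modnDml subnK 1?ltnW ?residue_lt // modnn mod0n.
Qed.

HB.instance Definition _ (p : nat) (p_pr : prime p) :=
  GRing.isZmodule.Build (padic_int p_pr) (@padic_addA p p_pr)
    (@padic_addC p p_pr) (@padic_add0 p p_pr) (@padic_addN p p_pr).

Lemma padic_mulA (p : nat) (p_pr : prime p) : associative (@padic_mul p p_pr).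
Proof.
by move=> x y z; apply: padic_ext => n /=; rewrite !modn_mod modnMml modnMmr mulnA.
Qed.

Lemma padic_mulC (p : nat) (p_pr : prime p) : commutative (@padic_mul p p_pr).
Proof. by move=> x y; apply: padic_ext => n /=; rewrite mulnC. Qed.

Lemma padic_mul1 (p : nat) (p_pr : prime p) :
  left_id (padic_one p_pr) (@padic_mul p p_pr).
Proof.
by move=> x; apply: padic_ext => n /=; rewrite modn_mod modnMml mul1n.
Qed.

Lemma padic_mulDl (p : nat) (p_pr : prime p) :
  left_distributive (@padic_mul p p_pr) (@padic_add p p_pr).
Proof.
move=> x y z; apply: padic_ext => n /=.
by rewrite !modn_mod modnMml modnDml modnDmr mulnDl.
Qed.

Lemma padic_one_neq0 (p : nat) (p_pr : prime p) :
  padic_one p_pr != (0 : padic_int p_pr).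
Proof.
apply/eqP => /(congr1 (fun x => residue x 1)) /=.
by rewrite expn1 mod0n modn_small ?prime_gt1.
Qed.

HB.instance Definition _ (p : nat) (p_pr : prime p) :=
  GRing.Zmodule_isComNzRing.Build (padic_int p_pr) (@padic_mulA p p_pr)
    (@padic_mulC p p_pr) (@padic_mul1 p p_pr) (@padic_mulDl p p_pr)
    (padic_one_neq0 p_pr).

Lemma residueD (p : nat) (p_pr : prime p) (x y : padic_int p_pr) n :
  (residue (x + y)%R n = (residue x n + residue y n) %% p ^ n)%N.
Proof. by []. Qed.

Lemma residueM (p : nat) (p_pr : prime p) (x y : padic_int p_pr) n :
  (residue (x * y)%R n = (residue x n * residue y n) %% p ^ n)%N.
Proof. by []. Qed.

Lemma residue_nat (p : nat) (p_pr : prime p) (k n : nat) :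
  (residue (k%:R : padic_int p_pr)%R n = k %% p ^ n)%N.
Proof.
elim: k => [//|k IH].
by rewrite -addn1 natrD residueD IH /= modnDm.
Qed.

(* <x>_p, the least nonnegative residue of x modulo p *)
Definition padic_lnr (p : nat) (p_pr : prime p) (x : padic_int p_pr) : nat :=
  residue x 1.

Definition padic_unit (p : nat) (p_pr : prime p) : {pred padic_int p_pr} :=
  [pred x | ~~ (p %| residue x 1)%N].

Lemma padic_inv_subproof1 (p : nat) (p_pr : prime p) (x : padic_int p_pr) m n :
  padic_unit x -> (m <= n)%N ->
  (residue x n ^ (totient (p ^ n)).-1 * residue x n = 1 %[mod p ^ m])%N.
Proof.
move=> ux mn; rewrite -expnSr prednK ?totient_gt0 ?expn_gt0 ?prime_gt0 //.
have /(congr1 (fun k => k %% p ^ m)%N) :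
  (residue x n ^ totient (p ^ n) = 1 %[mod p ^ n])%N.
  apply: Euler_exp_totient; case: n {mn} => [|n]; first by rewrite coprimen1.
  rewrite coprimeXr // coprime_sym prime_coprime //.
  by move: ux; rewrite /padic_unit /= -(residueP x (ltn0Sn n)) /dvdn expn1 modn_mod.
by rewrite !modn_dvdm ?dvdn_exp2l.
Qed.

Lemma padic_inv_subproof (p : nat) (p_pr : prime p) (x : padic_int p_pr) :
  padic_unit x -> forall m n, (m <= n ->
  residue x n ^ (totient (p ^ n)).-1 =
  residue x m ^ (totient (p ^ m)).-1 %[mod p ^ m])%N.
Proof.
move=> ux m n mn.
set u := (residue x n ^ _)%N; set v := (residue x m ^ _)%N.
have hu : (u * residue x m = 1 %[mod p ^ m])%N.
  by rewrite -modnMmr -(residueP x mn) modn_mod modnMmr padic_inv_subproof1.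
have hv : (v * residue x m = 1 %[mod p ^ m])%N by rewrite padic_inv_subproof1.
rewrite -[u]muln1 -modnMmr -hv modnMmr mulnCA -modnMmr hu modnMmr.
by rewrite muln1.
Qed.

Definition padic_inv (p : nat) (p_pr : prime p) (x : padic_int p_pr) :=
  match boolP (padic_unit x) with
  | AltTrue ux => padic_of p_pr (padic_inv_subproof ux)
  | AltFalse _ => x
  end.

Lemma padic_mulV (p : nat) (p_pr : prime p) :
  {in @padic_unit p p_pr, left_inverse 1 (@padic_inv p p_pr) *%R}.
Proof.
move=> x; rewrite inE => ux; apply: padic_ext => n; rewrite /padic_inv.
case: {-}_ / boolP => [ux'|/negP[]//].
by rewrite residueM /= !modn_mod modnMml padic_inv_subproof1.
Qed.

Lemma padic_unitPl (p : nat) (p_pr : prime p) (x y : padic_int p_pr) :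
  y * x = 1 -> padic_unit x.
Proof.
move/(congr1 (fun x => residue x 1)); rewrite residueM /= expn1 /padic_unit /= => yx.
apply/negP => dx; have := prime_gt1 p_pr => p1; move: yx.
by rewrite (eqP (dvdn_mull _ dx)) modn_small.
Qed.

Lemma padic_inv_out (p : nat) (p_pr : prime p) :
  {in [predC @padic_unit p p_pr], @padic_inv p p_pr =1 id}.
Proof.
move=> x; rewrite inE /= => ux; rewrite /padic_inv.
by case: {-}_ / boolP => // ux'; case/negP: ux.
Qed.

HB.instance Definition _ (p : nat) (p_pr : prime p) :=
  GRing.ComNzRing_hasMulInverse.Build (padic_int p_pr)
    (@padic_mulV p p_pr) (@padic_unitPl p p_pr) (@padic_inv_out p p_pr).

(* x |-> (x - <x>_p) / p, well defined on Z_p *)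
Lemma padic_divp_subproof (p : nat) (p_pr : prime p) (x : padic_int p_pr) m n :
  (m <= n ->
   residue x n.+1 %/ p = residue x m.+1 %/ p %[mod p ^ m])%N.
Proof.
move=> mn; have p0 := prime_gt0 p_pr; apply/eqP.
suff : (residue x n.+1 %/ p * p == residue x m.+1 %/ p * p %[mod p ^ m * p])%N.
  by rewrite -!muln_modl // eqn_pmul2r.
rewrite -(eqn_modDr (residue x 1)) -{1}(@residueP _ _ x 1 n.+1) //.
rewrite -(@residueP _ _ x 1 m.+1) // !expn1 -!divn_eq -expnSr.
by rewrite (residueP x) // residue_mod.
Qed.

Definition padic_divp (p : nat) (p_pr : prime p) (x : padic_int p_pr) :=
  padic_of p_pr (padic_divp_subproof x).

Lemma padic_divpE (p : nat) (p_pr : prime p) (x : padic_int p_pr) :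
  x = padic_divp x * p%:R + (padic_lnr x)%:R.
Proof.
apply: padic_ext => n; rewrite residueD residueM !residue_nat /=.
rewrite !modn_mod modnMm modnDm /padic_lnr -(@residueP _ _ x 1 n.+1) //.
by rewrite expn1 -divn_eq !residueP.
Qed.

(* alpha_p^* = (alpha + <-alpha>_p) / p *)
Definition padic_dash (p : nat) (p_pr : prime p) (a : padic_int p_pr) :=
  padic_divp (a + (padic_lnr (- a))%:R).

Lemma padic_dashE (p : nat) (p_pr : prime p) (a : padic_int p_pr) :
  padic_dash a * p%:R = a + (padic_lnr (- a))%:R.
Proof.
rewrite [RHS]padic_divpE [X in _ + X](_ : _ = 0) ?addr0 //.
rewrite /padic_lnr residueD residue_nat modnDmr -residueD addrN.
by rewrite (residue_nat p_pr 0) mod0n.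
Qed.

Definition padic_eqmod (p : nat) (p_pr : prime p) (k : nat)
  (x y : padic_int p_pr) : Prop := exists z, x - y = z * p%:R ^+ k.

Lemma padic_eqmod_refl (p : nat) (p_pr : prime p) k (x : padic_int p_pr) :
  padic_eqmod k x x.
Proof. by exists 0; rewrite subrr mul0r. Qed.

Lemma residue_eq0 (p : nat) (p_pr : prime p) k (x : padic_int p_pr) :
  residue x k = 0%N <-> exists z, x = z * p%:R ^+ k.
Proof.
split=> [|[z ->]]; last first.
  by rewrite residueM -natrX residue_nat modnn muln0 mod0n.
elim: k x => [|k IH] x xk; first by exists x; rewrite expr0 mulr1.
have x1 : padic_lnr x = 0%N by rewrite /padic_lnr -(@residueP _ _ x 1 k.+1) // xk mod0n.
have [|z zE] := IH (padic_divp x); first by rewrite /= xk div0n mod0n.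
by exists z; rewrite exprSr mulrA -zE {1}[x]padic_divpE x1 addr0.
Qed.

Lemma padic_eqmodP (p : nat) (p_pr : prime p) k (x y : padic_int p_pr) :
  padic_eqmod k x y <-> residue x k = residue y k.
Proof.
rewrite /padic_eqmod -residue_eq0; split=> [xy|xy].
  by rewrite -[x](subrK y) residueD xy add0n residue_mod.
by rewrite residueD xy -residueD subrr (residue_nat p_pr 0) mod0n.
Qed.

Lemma padic_unitP (p : nat) (p_pr : prime p) (x : padic_int p_pr) :
  x \is a GRing.unit <-> ~ exists z, x = z * p%:R.
Proof.
rewrite -[p%:R]expr1 -residue_eq0.
rewrite [x \is a GRing.unit](_ : _ = ~~ (p %| residue x 1)%N) // /dvdn.
have := residue_lt x 1; rewrite expn1 => xp.
by rewrite modn_small //; split=> /eqP.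
Qed.

Definition padic_continuous (p : nat) (p_pr : prime p)
  (G : padic_int p_pr -> padic_int p_pr) : Prop :=
  forall x k, exists m, forall y,
    padic_eqmod m y x -> padic_eqmod k (G y) (G x).

Definition morita_nat (p : nat) (p_pr : prime p) (n : nat) : padic_int p_pr :=
  (-1) ^+ n * \prod_(1 <= k < n | ~~ (p %| k)%N) k%:R.

Definition is_morita_gamma (p : nat) (p_pr : prime p)
  (G : padic_int p_pr -> padic_int p_pr) : Prop :=
  [/\ G 0 = 1,
      (forall n : nat, (0 < n)%N -> G n%:R = morita_nat p_pr n) &
      padic_continuous G].

(* The continuous function extending the values on nat; see morita_gammaP for
   existence when p is odd, and morita_gamma_unique for uniqueness. *)
Definition morita_gamma (p : nat) (p_pr : prime p) :
  padic_int p_pr -> padic_int p_pr :=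
  xget (fun=> 0) [set G | @is_morita_gamma p p_pr G]%classic.

Lemma morita_gamma_unique (p : nat) (p_pr : prime p)
    (G H : padic_int p_pr -> padic_int p_pr) :
  is_morita_gamma G -> is_morita_gamma H -> G = H.
Proof.
move=> [G0 Gn Gc] [H0 Hn Hc]; apply/funext => x; apply: padic_ext => k.
have GH (n : nat) : G n%:R = H n%:R.
  by case: n => [|n]; [rewrite G0 H0 | rewrite Gn // Hn].
have [m /(_ (residue x (maxn m _))%:R) hG] := Gc x k.
have [m' /(_ (residue x (maxn m m'))%:R) hH] := Hc x k.
have -> : residue (G x) k = residue (G (residue x (maxn m m'))%:R) k.
  apply/esym/padic_eqmodP/hG/padic_eqmodP.
  by rewrite residue_nat residueP // leq_maxl.
rewrite GH; congr (_ %% _)%N; apply/padic_eqmodP/hH/padic_eqmodP.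
by rewrite residue_nat residueP // leq_maxr.
Qed.

Lemma Wilson_pexp (p m : nat) : prime p -> odd p -> (0 < m)%N ->
  (p ^ m %| (\prod_(0 <= k < p ^ m | ~~ (p %| k)) k).+1)%N.
Proof.
move=> p_pr p_odd m0; set q := (p ^ m)%N.
have p1 := prime_gt1 p_pr; have p0 := prime_gt0 p_pr.
have q1 : (1 < q)%N by rewrite -(exp1n m) ltn_exp2r.
have q2 : (2 < q)%N.
  have : odd q by rewrite oddX p_odd orbT.
  by move: q1; case: (q) => [|[|[|]]].
have cop k : coprime q k = ~~ (p %| k)%N by rewrite coprime_pexpl // prime_coprime.
suff h : ((\prod_(0 <= k < q | ~~ (p %| k)) k)%N%:R : 'Z_q) = -1.
  have : ((\prod_(0 <= k < q | ~~ (p %| k)) k).+1%N%:R : 'Z_q) = 0.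
    by rewrite mulrS h subrr.
  by move/(congr1 val); rewrite /= val_Zp_nat // => /eqP.
have -> : ((\prod_(0 <= k < q | ~~ (p %| k)) k)%N%:R : 'Z_q) =
    \prod_(u : 'Z_q | u \is a GRing.unit) u.
  rewrite natr_prod big_mkord.
  have e : q = (Zp_trunc q).+2 by rewrite Zp_cast.
  rewrite (reindex (cast_ord e)); last first.
    by exists (cast_ord (esym e)) => i _; rewrite ?cast_ordK ?cast_ordKV.
  apply: eq_big => [i|i _]; last by apply: val_inj; rewrite /= val_Zp_nat // modn_small.
  rewrite -cop -unitZpE //; congr (_ \is a _).
  by apply: val_inj; rewrite /= val_Zp_nat // modn_small.
have inv_half : \prod_(u : 'Z_q | (u \is a GRing.unit) && (u^-1 < u)%N) u =
    \prod_(u : 'Z_q | (u \is a GRing.unit) && (u < u^-1)%N) u^-1.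
  rewrite (reindex_inj (can_inj (@invrK _))).
  by apply: eq_bigl => u; rewrite unitrV invrK.
rewrite (bigID (fun u : 'Z_q => (u < u^-1)%N)) /=.
rewrite [X in _ * X](bigID (fun u : 'Z_q => (u^-1 < u)%N)) /=.
rewrite [X in _ * (X * _)](_ : _ =
    \prod_(u : 'Z_q | (u \is a GRing.unit) && (u < u^-1)%N) u^-1); last first.
  rewrite -inv_half; apply: eq_bigl => u; case: (u \is a _) => //=.
  by case: ltngtP.
rewrite mulrA -big_split /= big1 ?mul1r; last first.
  by move=> u /andP[uu _]; rewrite divrr.
have n1 : (-1 : 'Z_q) != 1.
  apply/eqP => h; have : (2%:R : 'Z_q) = 0 by rewrite mulr2n -{1}h addNr.
  by move/(congr1 (@nat_of_ord _)); rewrite val_Zp_nat // modn_small.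
rewrite (eq_bigl (pred2 1 (-1))); last first.
  move=> u /=; rewrite -andbA -!leqNgt.
  apply/idP/idP => [/and3P[uu h1 h2]|/orP[/eqP->|/eqP->]]; last 2 first.
  - by rewrite unitr1 invr1 leqnn.
  - by rewrite unitrN1 invrN invr1 leqnn.
  have uV : u^-1 = u by apply: val_inj; apply/eqP; rewrite eqn_leq h1 h2.
  have : (u - 1) * (u + 1) = 0.
    by rewrite -subr_sqr expr1n expr2 -{1}uV mulVr // subrr.
  have := natr_Zp u; set v : nat := u => vE.
  have v0 : (0 < v)%N.
    rewrite lt0n; apply: contraTneq uu => v0.
    by rewrite -vE v0 unitr0.
  case: (boolP (p %| v.+1)%N) => pv.
    have uN : u - 1 \is a GRing.unit.
      rewrite -vE -{1}(prednK v0) -addn1 natrD addrK unitZpE // cop.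
      apply/negP => pv'; have := dvdn_sub pv pv'.
      rewrite -{1}(prednK v0) -addn2 addKn => /(dvdn_leq (isT : 0 < 2)%N) p2.
      by move: p_odd; rewrite (_ : p = 2) //; apply/eqP; rewrite eqn_leq p2.
    move/(congr1 (fun x => (u - 1)^-1 * x)); rewrite mulKr // mulr0 => /eqP.
    by rewrite addr_eq0 => ->; rewrite orbT.
  have uP : u + 1 \is a GRing.unit by rewrite -vE natr1 unitZpE // cop.
  move/(congr1 (fun x => x / (u + 1))); rewrite mulrK // mul0r => /eqP.
  by rewrite subr_eq0 => ->.
rewrite (bigD1 1) ?eqxx //= mul1r (big_pred1 (-1)) // => u /=.
by case: (eqVneq u 1) => [->|]; rewrite ?andbF //= ?andbT // eq_sym (negPf n1).
Qed.


Lemma morita_nat_periodic (p : nat) (p_pr : prime p) (m a b : nat) : odd p ->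
  (a = b %[mod p ^ m])%N ->
  residue (morita_nat p_pr a) m = residue (morita_nat p_pr b) m.
Proof.
move=> p_odd; case: m => [|m].
  by rewrite -(residue_mod _ 0) -(residue_mod (morita_nat _ b)) !expn0 !modn1.
set q := (p ^ m.+1)%N => ab.
have p0 := prime_gt0 p_pr.
pose Q c := (\prod_(0 <= k < c | ~~ (p %| k)) k)%N.
have moritaE c : morita_nat p_pr c = (-1) ^+ c * (Q c)%:R.
  rewrite /morita_nat /Q natr_prod; case: c => [|c]; first by rewrite !big_geq.
  by rewrite [in RHS]big_mkcond big_nat_recl //= dvdn0 /= mul1r [in LHS]big_mkcond /=
     big_add1.
have QD c : Q (q + c)%N = (Q q * \prod_(0 <= k < c | ~~ (p %| k)) (q + k))%N.
  rewrite /Q (big_cat_nat (n := q)) ?leq_addr //=; congr (_ * _)%N.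
  have := big_addn 0 (q + c) q (fun k => ~~ (p %| k)%N) id.
  rewrite add0n addKn => ->; apply: eq_big => [k|k _].
    by rewrite dvdn_addl // dvdn_exp.
  by rewrite addnC.
have step c : residue (morita_nat p_pr (q + c)) m.+1 = residue (morita_nat p_pr c) m.+1.
  apply/padic_eqmodP; rewrite /padic_eqmod !moritaE exprD -signr_odd oddX p_odd orbT.
  rewrite expr1 mulN1r mulNr -opprD -mulrDr -natrD -mulNr.
  have /dvdnP[z ->] : (q %| Q (q + c) + Q c)%N.
    rewrite QD; have e : (\prod_(0 <= k < c | ~~ (p %| k)) (q + k) = Q c %[mod q])%N.
      rewrite /Q; elim/big_ind2: _ => // [x x' y y' h h'|k _].
        by rewrite -modnMm h h' modnMm.
      by rewrite modnDl.
    rewrite /dvdn -modnDml -modnMmr e modnMmr modnDml -mulSnr.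
    by rewrite -/(dvdn q _) dvdn_mulr // Wilson_pexp.
  by rewrite natrM natrX; exists (- (-1) ^+ c * z%:R); rewrite !mulNr mulrA.
have stepn n c : residue (morita_nat p_pr (n * q + c)) m.+1 =
                 residue (morita_nat p_pr c) m.+1.
  by elim: n => [//|n IH]; rewrite mulSn -addnA step.
by rewrite (divn_eq a q) (divn_eq b q) ab !stepn.
Qed.

Lemma morita_gamma_subproof (p : nat) (p_pr : prime p) (p_odd : odd p)
    (x : padic_int p_pr) m n :
  (m <= n ->
   residue (morita_nat p_pr (residue x n)) n =
   residue (morita_nat p_pr (residue x m)) m %[mod p ^ m])%N.
Proof.
move=> mn; rewrite residueP // residue_mod; apply: morita_nat_periodic => //.
exact: residue_eqmod.
Qed.

Lemma morita_gammaP (p : nat) (p_pr : prime p) :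
  odd p -> is_morita_gamma (@morita_gamma p p_pr).
Proof.
move=> p_odd; rewrite /morita_gamma.
pose G x := padic_of p_pr (@morita_gamma_subproof p p_pr p_odd x).
apply: (@xgetPex _ _ [set G | is_morita_gamma G]%classic); exists G.
have Gn n : G n%:R = morita_nat p_pr n.
  apply: padic_ext => k /=; rewrite modn_mod; congr (_ %% _)%N.
  by apply: morita_nat_periodic => //; rewrite residue_nat modn_mod.
split=> // [|x k].
  by rewrite -[0]/(0%:R) Gn /morita_nat big_geq // mulr1.
exists k => y /padic_eqmodP yx; apply/padic_eqmodP => /=.
by rewrite yx.
Qed.

Definition pochhammer (R : pzRingType) (x : R) (k : nat) : R :=
  \prod_(i < k) (x + i%:R).

Definition g_p (p : nat) (p_pr : prime p) (a : padic_int p_pr) :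
    padic_int p_pr :=
  let Gam := @morita_gamma p p_pr in
  (Gam (1 + 1 / 2%:R * a) * Gam (1 - 3%:R / 2%:R * a)) /
  (Gam (1 + a) * Gam (1 - a) * Gam (1 - 1 / 2%:R * a) ^+ 2).

(* Main.v *)
(* Write a for the residue of -alpha and alpha = -a + p t.  In the well-poised sum
   T(A, B, C) = sum_k (A)_k (B)_k (C)_k / (k! (1+A-B)_k (1+A-C)_k), put
   A = -a + p t e_0, B = -a + p t e_1, C = -a + p t e_2 with e in {0,1}^3.  When
   some e_i = 0 the sum terminates and Dixon's theorem evaluates it; iterating the
   contiguous relation
     T(A, B, C) = (1+A)(A-2B-2C) / ((1+A-B)(1+A-C)) T(A+2, B+1, C+1)
   and comparing with the functional equation of Gamma_p gives the value as an
   explicit factor, made of the multiples of p met on the way, times a quotient of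
   values of Gamma_p.  Both sides are functions on the cube whose mixed differences
   of order k <= 3 are divisible by p^k, by a Taylor expansion of Gamma_p.  They
   agree at seven corners, hence modulo p^3 at the corner A = B = C = alpha. *)
From HB Require Import structures.
Require Import Defs.
From mathcomp Require Import all_boot all_order all_algebra all_field.
From mathcomp Require Import ring zify.

Set Implicit Arguments.
Unset Strict Implicit.
Unset Printing Implicit Defensive.

Import Order.TTheory GRing.Theory Num.Theory.
Local Open Scope ring_scope.

(** * Divisibility of mixed differences on a cube *)

Section MixedDifferences.
Variables (R : comUnitRingType) (q : R).

Definition pow_dvd k (x : R) := exists z, x = z * q ^+ k.

Lemma pow_dvd0 k : pow_dvd k 0.
Proof. by exists 0; rewrite mul0r. Qed.

Lemma pow_dvdW k l x : (l <= k)%N -> pow_dvd k x -> pow_dvd l x.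
Proof.
by move=> lk [z ->]; exists (z * q ^+ (k - l)); rewrite -mulrA -exprD subnK.
Qed.

Lemma pow_dvdD k x y : pow_dvd k x -> pow_dvd k y -> pow_dvd k (x + y).
Proof. by move=> [z ->] [z' ->]; exists (z + z'); rewrite mulrDl. Qed.

Lemma pow_dvdM k l x y : pow_dvd k x -> pow_dvd l y -> pow_dvd (k + l) (x * y).
Proof.
by move=> [z ->] [z' ->]; exists (z * z'); rewrite exprD mulrACA.
Qed.

Lemma pow_dvdMl k x y : pow_dvd k y -> pow_dvd k (x * y).
Proof. by move=> [z ->]; exists (x * z); rewrite mulrA. Qed.

(* A function on the cube {0,1}^n whose mixed differences of order k, based at
   the origin, are divisible by q ^+ w k. *)
Fixpoint mixdvd n (w : nat -> nat) (f : seq bool -> R) : Prop :=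
  if n is n'.+1 then
    mixdvd n' w (fun s => f (false :: s)) /\
    mixdvd n' (fun k => w k.+1) (fun s => f (true :: s) - f (false :: s))
  else pow_dvd (w 0) (f [::]).

Lemma mixdvd_ext n w f g : f =1 g -> mixdvd n w f -> mixdvd n w g.
Proof.
elim: n w f g => [|n IH] w f g fg /=; first by rewrite fg.
by case=> h0 h1; split; [apply: IH h0|apply: IH h1] => s; rewrite !fg.
Qed.

Lemma mixdvdW n w w' f :
  (forall k, w' k <= w k)%N -> mixdvd n w f -> mixdvd n w' f.
Proof.
elim: n w w' f => [|n IH] w w' f ww /=; first exact: pow_dvdW.
by case=> h0 h1; split; [apply: IH h0|apply: IH h1] => k; apply: ww.
Qed.

(** A mixed difference of any order is a signed sum of values, each divisible by [q ^+ D]. *)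
Lemma mixdvd_of_dvd n w D f :
  (forall k, w k <= D)%N -> (forall s, pow_dvd D (f s)) -> mixdvd n w f.
Proof.
elim: n w f => [|n IH] w f wD fD /=; first exact: pow_dvdW (wD 0%N) _.
split; apply: IH => // s; apply: pow_dvdD => //.
by rewrite -mulN1r; apply: pow_dvdMl.
Qed.

Lemma mixdvd0 n w : mixdvd n w (fun=> 0).
Proof.
elim: n w => [|n IH] w /=; first exact: pow_dvd0.
by split => //; apply: mixdvd_ext (IH _) => s; rewrite subrr.
Qed.

Lemma mixdvd_cst n w c : pow_dvd (w 0%N) c -> mixdvd n w (fun=> c).
Proof.
elim: n => [|n IH] //= wc; split; first exact: IH.
by apply: mixdvd_ext (mixdvd0 _ _) => s; rewrite subrr.
Qed.

Lemma mixdvdD n w f g : mixdvd n w f -> mixdvd n w g ->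
  mixdvd n w (fun s => f s + g s).
Proof.
elim: n w f g => [|n IH] w f g /=; first exact: pow_dvdD.
move=> [f0 f1] [g0 g1]; split; first exact: IH.
by apply: mixdvd_ext (IH _ _ _ f1 g1) => s; ring.
Qed.

(** Discrete Leibniz rule: the difference of [f * g] is (difference of [f]) times [g] on the far
    face plus [f] on the near face times (difference of [g]). Monotonicity of [w'] ensures that [g]
    keeps the weight [w'] on the far face. *)
Lemma mixdvdM n w w' w'' f g :
  {homo w' : k l / (k <= l)%N} -> (forall k l, w'' (k + l) <= w k + w' l)%N ->
  mixdvd n w f -> mixdvd n w' g -> mixdvd n w'' (fun s => f s * g s).
Proof.
elim: n w w' w'' f g => [|n IH] w w' w'' f g mono ww /=.
  by move=> hf hg; apply: pow_dvdW (ww 0 0)%N _; apply: pow_dvdM.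
move=> [f0 f1] [g0 g1]; split; first exact: (IH w w').
have monoS : {homo (fun k => w' k.+1) : k l / (k <= l)%N}.
  by move=> k l kl; apply: mono.
have gt : mixdvd n w' (fun s => g (true :: s)).
  apply: (@mixdvd_ext _ _ (fun s => g (false :: s) +
    (g (true :: s) - g (false :: s)))) => [s|]; first by ring.
  by apply: mixdvdD => //; apply: mixdvdW g1 => k; apply: mono.
apply: (@mixdvd_ext _ _ (fun s => (f (true :: s) - f (false :: s)) * g (true :: s)
  + f (false :: s) * (g (true :: s) - g (false :: s)))) => [s|]; first by ring.
apply: mixdvdD; [apply: IH mono _ f1 gt|apply: IH monoS _ f0 g1] => k l.
- by rewrite -addSn.
- by rewrite -addnS.
Qed.

(** A coordinate vanishes at the origin and has no differences of order 2 or more, so only [w 1] is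
    constrained. *)
Lemma mixdvd_coord n w t i : (w 1 <= 1)%N ->
  mixdvd n w (fun s => (nth false s i)%:R * (t * q)).
Proof.
move=> w1; elim: n i => [|n IH] i /=.
  by rewrite nth_nil mul0r; apply: pow_dvd0.
case: i => [|i] /=; split.
- by apply: mixdvd_ext (mixdvd0 _ _) => s; rewrite mul0r.
- apply: (@mixdvd_ext _ _ (fun=> t * q)) => [s|]; first by rewrite mul0r subr0 mul1r.
  by apply: mixdvd_cst; apply: pow_dvdW w1 _; exists t; rewrite expr1.
- exact: IH.
- by apply: mixdvd_ext (mixdvd0 _ _) => s; rewrite subrr.
Qed.

(** The difference of top order is an alternating sum over all corners, in which a single term
    survives. *)
Lemma mixdvd_corner n w f : mixdvd n w f ->
  (forall s, size s = n -> s != nseq n true -> f s = 0) ->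
  pow_dvd (w n) (f (nseq n true)).
Proof.
elim: n w f => [|n IH] w f //= [_ f1] f0.
have /(IH _ _ f1): forall s, size s = n -> s != nseq n true ->
    f (true :: s) - f (false :: s) = 0.
  move=> s sn st; rewrite !f0 /= ?sn ?subr0 //.
by rewrite (f0 (false :: _)) ?subr0 //= size_nseq.
Qed.

Variables n d : nat.

(** Capping the weight at [d] makes every multiple of [q ^+ d] smooth, so that the remainder of an
    expansion to precision [d] is harmless. *)
Definition smooth := mixdvd n (minn^~ d).

Lemma smooth_ext f g : f =1 g -> smooth f -> smooth g.
Proof. exact: mixdvd_ext. Qed.

Lemma smooth_of_dvd f : (forall s, pow_dvd d (f s)) -> smooth f.
Proof. by apply: mixdvd_of_dvd => k; apply: geq_minr. Qed.

Lemma smooth_cst c : smooth (fun=> c).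
Proof. by apply: mixdvd_cst; exists c; rewrite min0n mulr1. Qed.

Lemma smoothD f g : smooth f -> smooth g -> smooth (fun s => f s + g s).
Proof. exact: mixdvdD. Qed.

Lemma smoothM f g : smooth f -> smooth g -> smooth (fun s => f s * g s).
Proof. apply: mixdvdM => [k l|k l]; lia. Qed.

Lemma smoothN f : smooth f -> smooth (fun s => - f s).
Proof.
move=> h; apply: smooth_ext (smoothM (smooth_cst (-1)) h) => s.
by rewrite mulN1r.
Qed.

Lemma smooth_prod (I : finType) (F : I -> seq bool -> R) :
  (forall i, smooth (F i)) -> smooth (fun s => \prod_i F i s).
Proof.
move=> h; elim: (index_enum I) => [|i r IH].
  by apply: smooth_ext (smooth_cst 1) => s; rewrite big_nil.
by apply: smooth_ext (smoothM (h i) IH) => s; rewrite big_cons.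
Qed.

Lemma smooth_sum (I : finType) (F : I -> seq bool -> R) :
  (forall i, smooth (F i)) -> smooth (fun s => \sum_i F i s).
Proof.
move=> h; elim: (index_enum I) => [|i r IH].
  by apply: smooth_ext (smooth_cst 0) => s; rewrite big_nil.
by apply: smooth_ext (smoothD (h i) IH) => s; rewrite big_cons.
Qed.

(* 1 / f = u^-1 (1 + e + e ^+ 2) + e ^+ 3 / f for e := 1 - f / u, and q
   divides e. *)
Lemma smoothV f u : (d <= 3)%N -> u \is a GRing.unit -> (forall s, f s \is a GRing.unit) ->
  (forall s, pow_dvd 1 (f s - u)) -> smooth f -> smooth (fun s => (f s)^-1).
Proof.
move=> d3 uu fu fq sf.
have se : smooth (fun s => 1 - u^-1 * f s).
  by apply: smoothD (smooth_cst _) _; apply/smoothN/smoothM/sf/smooth_cst.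
apply: (@smooth_ext (fun s => u^-1 * (1 + (1 - u^-1 * f s)
    + (1 - u^-1 * f s) * (1 - u^-1 * f s)) + (1 - u^-1 * f s) ^+ 3 / f s)) => [s|].
  apply: (mulIr (fu s)); rewrite mulrDl mulVr // -(mulrA _ (f s)^-1) mulVr //.
  by rewrite mulr1; ring.
apply: smoothD.
  apply: smoothM; first exact: smooth_cst.
  by apply: smoothD; [apply: smoothD => //; apply: smooth_cst|apply: smoothM].
apply: smooth_of_dvd => s; apply: (pow_dvdW d3); rewrite mulrC.
have -> : 1 - u^-1 * f s = - u^-1 * (f s - u).
  by rewrite mulrBr !mulNr mulVr // opprK addrC.
rewrite exprMn; apply/pow_dvdMl/pow_dvdMl.
have [z ->] := fq s; exists (z ^+ 3); by rewrite expr1 exprMn.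
Qed.

End MixedDifferences.

(** * Truncated well-poised sums and their contiguous relation *)

Section Pochhammer.
Variable R : comUnitRingType.
Implicit Types A B C : R.

Lemma pochhammer0 A : pochhammer A 0 = 1.
Proof. exact: big_ord0. Qed.

Lemma pochhammerSr A k : pochhammer A k.+1 = pochhammer A k * (A + k%:R).
Proof. exact: big_ord_recr. Qed.

Lemma pochhammerSl A k : pochhammer A k.+1 = A * pochhammer (A + 1) k.
Proof.
rewrite /pochhammer big_ord_recl addr0; congr (_ * _).
by apply: eq_bigr => i _; rewrite -addrA -mulrS.
Qed.

Lemma pochhammer1 k : pochhammer 1 k = k`!%:R :> R.
Proof.
elim: k => [|k IH]; first by rewrite pochhammer0.
by rewrite pochhammerSr IH factS natrM mulrC mulrS.
Qed.

Lemma pochhammer_eq0 A n k : (n < k)%N -> A + n%:R = 0 -> pochhammer A k = 0.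
Proof. by move=> nk An; rewrite /pochhammer (bigD1 (Ordinal nk)) //= An mul0r. Qed.

Lemma pochhammer_unit A k :
  (forall i, (i < k)%N -> A + i%:R \is a GRing.unit) ->
  pochhammer A k \is a GRing.unit.
Proof.
elim: k => [|k IH] h; first by rewrite pochhammer0 unitr1.
by rewrite pochhammerSr unitrM h // IH // => i ik; apply: h; lia.
Qed.

(** Term of the well-poised 3F2(A, B, C; 1+A-B, 1+A-C; 1). For A = B = C both lower parameters are 1
    and the term is (A)_k^3 / k!^3. *)
Definition dixon_term A B C k :=
  pochhammer A k * pochhammer B k * pochhammer C k /
  (k`!%:R * pochhammer (1 + A - B) k * pochhammer (1 + A - C) k).

Definition dixon_sum N A B C := \sum_(k < N) dixon_term A B C k.

Definition dixon_factor A B C :=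
  (1 + A) * (A - 2%:R * B - 2%:R * C) / ((1 + A - B) * (1 + A - C)).

Lemma dixon_termC A B C k : dixon_term A B C k = dixon_term A C B k.
Proof. by rewrite /dixon_term [X in X / _]mulrAC [X in _ / X]mulrAC. Qed.

Lemma dixon_sumC N A B C : dixon_sum N A B C = dixon_sum N A C B.
Proof. by apply: eq_bigr => k _; apply: dixon_termC. Qed.

Lemma dixon_term0 A B C : dixon_term A B C 0 = 1.
Proof. by rewrite /dixon_term !pochhammer0 !mulr1 divr1. Qed.

(** Truncating the two series leaves one boundary term. In the induction on [N], the new term on the
    left has to equal the new term on the right plus the increment of the boundary term, which is an
    identity of rational functions. *)
Lemma dixon_contiguous N A B C :
  (forall i, (0 < i <= N.+1)%N -> [/\ i%:R \is a @GRing.unit R,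
     A - B + i%:R \is a GRing.unit & A - C + i%:R \is a GRing.unit]) ->
  dixon_sum N.+2 A B C =
  dixon_factor A B C * dixon_sum N.+1 (A + 2%:R) (B + 1) (C + 1) +
  pochhammer (A + 1) N.+1 * pochhammer (B + 1) N.+1 * pochhammer (C + 1) N.+1 /
  (N.+1`!%:R * pochhammer (1 + A - B) N.+1 * pochhammer (1 + A - C) N.+1).
Proof.
have e2 : 1 + (A + 2%:R) = 1 + 1 + A + 1 by ring.
have eB : 1 + (A + 2%:R) - (B + 1) = 1 + A - B + 1 by ring.
have eC : 1 + (A + 2%:R) - (C + 1) = 1 + A - C + 1 by ring.
elim: N => [|N IH] hu.
  have [_ uB uC] := hu 1%N isT.
  rewrite /dixon_sum !big_ord_recl !big_ord0 /= !addr0 !dixon_term0 mulr1.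
  rewrite /dixon_term !pochhammerSr !pochhammer0 /= !addr0 ?mul1r.
  have {}uB : 1 + A - B \is a GRing.unit by rewrite -addrA addrC.
  have {}uC : 1 + A - C \is a GRing.unit by rewrite -addrA addrC.
  rewrite /dixon_factor; set D := (1 + A - B) * _.
  have uD : D \is a GRing.unit by rewrite unitrM uB uC.
  apply: (mulIr uD); rewrite !mulrDl -!mulrA mulVr // !mulr1 /D; ring.
rewrite /dixon_sum big_ord_recr /= -/(dixon_sum _ _ _ _) IH; last first.
  by move=> i /andP[i0 iN]; apply: hu; lia.
rewrite [in RHS]big_ord_recr /= -/(dixon_sum _ _ _ _) mulrDr -[LHS]addrA -[RHS]addrA; congr (_ + _).
have uP (D : R) : (forall i, (0 < i <= N.+2)%N -> D + i%:R \is a GRing.unit) ->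
    pochhammer (1 + D) N.+2 \is a GRing.unit.
  move=> uD; apply: pochhammer_unit => i iN.
  by rewrite addrAC -mulrS addrC uD.
have uf : N.+2`!%:R \is a @GRing.unit R.
  rewrite -pochhammer1 -[1]addr0; apply: uP => i iN.
  by rewrite add0r; case: (hu i iN).
have uB : pochhammer (1 + A - B) N.+2 \is a GRing.unit.
  by rewrite -addrA; apply: uP => i iN; case: (hu i iN).
have uC : pochhammer (1 + A - C) N.+2 \is a GRing.unit.
  by rewrite -addrA; apply: uP => i iN; case: (hu i iN).
(* [D] is a common denominator of all the terms. [clear] and [clear2] cancel a denominator against
   it, which leaves a polynomial identity. *)
pose D := N.+2`!%:R * pochhammer (1 + A - B) N.+2 * pochhammer (1 + A - C) N.+2.
have uD : D \is a GRing.unit by rewrite !unitrM uf uB uC.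
have clear d e x : D = d * e -> x / d * D = x * e.
  by move=> De; have := uD; rewrite {1}De unitrM => /andP[ud _]; rewrite De mulrA divrK.
have clear2 d1 d2 x y e : D = d1 * d2 * e -> x / d1 * (y / d2) * D = x * y * e.
  move=> De; have := uD; rewrite {1}De !unitrM -andbA => /and3P[u1 u2 _].
  have -> : x / d1 * (y / d2) = x * y / (d1 * d2) by rewrite invrM //; ring.
  exact: clear.
apply: (mulIr uD); rewrite !mulrDl.
rewrite (clear _ (N.+2%:R * (1 + A - B + N.+1%:R) * (1 + A - C + N.+1%:R))); last first.
  by rewrite /D factS natrM !(pochhammerSr _ N.+1); ring.
rewrite (clear _ 1) ?mulr1 // (clear _ 1) ?mulr1 //.
rewrite /dixon_factor /dixon_term eB eC.
rewrite (clear2 _ _ _ _ N.+2%:R); last first.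
  by rewrite /D factS natrM !(pochhammerSl _ N.+1); ring.
(* Every symbol is reduced to (A+2)_N, (B+1)_(N+1) or (C+1)_(N+1) times linear factors, so that
   [ring] can treat these three as atoms. *)
rewrite !(pochhammerSl A) !(pochhammerSl B) !(pochhammerSl C).
have -> : A + 2%:R = A + 1 + 1 by ring.
rewrite !(pochhammerSr (A + 1) N.+1) !(pochhammerSr (B + 1) N.+1) !(pochhammerSr (C + 1) N.+1).
rewrite !(pochhammerSl (A + 1) N).
rewrite (pochhammerSr (A + 1 + 1)).
ring.
Qed.
End Pochhammer.

(** * Units of Z_p, reduction modulo p, and products over one period *)

Section Gamma.
Variables (p : nat) (p_pr : prime p).
Notation Zp := (padic_int p_pr).
Notation Gam := (@morita_gamma p p_pr).

Lemma padic_unitE (x : Zp) : (x \is a GRing.unit) = ~~ (p %| residue x 1)%N.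
Proof. by []. Qed.

Lemma padic_unit_nat n : (n%:R \is a @GRing.unit Zp) = ~~ (p %| n)%N.
Proof. by rewrite padic_unitE residue_nat expn1 /dvdn modn_mod. Qed.

Lemma padic_unitD (x y : Zp) : pow_dvd p%:R 1 (x - y) ->
  (x \is a GRing.unit) = (y \is a GRing.unit).
Proof.
by move=> xy; rewrite !padic_unitE; have /padic_eqmodP-> : padic_eqmod 1 x y by [].
Qed.

Lemma padic_unitDp (x y : Zp) : (x + y * p%:R \is a GRing.unit) = (x \is a GRing.unit).
Proof. by apply: padic_unitD; exists y; rewrite expr1 addrAC subrr add0r. Qed.

(** Up to sign, this is the ratio of the values of Gamma_p at x + 1 and x; see [gammaS]. *)
Definition unit_factor (x : Zp) : Zp := if x \is a GRing.unit then x else 1.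

Lemma unit_factor_unit x : unit_factor x \is a GRing.unit.
Proof. by rewrite /unit_factor; case: ifP => // _; apply: unitr1. Qed.

Definition to_Fp (x : Zp) : 'F_p := (residue x 1)%:R.

Lemma Fp_nat_mod n : (n %% p ^ 1)%:R = n%:R :> 'F_p.
Proof.
apply: val_inj; rewrite expn1 /= !val_Fp_nat ?modn_mod //.
Qed.

Lemma to_Fp_is_zmod : zmod_morphism to_Fp.
Proof.
move=> x y; apply/eqP; rewrite eq_sym subr_eq; apply/eqP.
rewrite /to_Fp -natrD -Fp_nat_mod -[in RHS]Fp_nat_mod -residueD subrK.
by rewrite Fp_nat_mod.
Qed.

Lemma to_Fp_is_monoid : monoid_morphism to_Fp.
Proof.
split=> [|x y]; last by rewrite /to_Fp residueM Fp_nat_mod natrM.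
by rewrite /to_Fp -[1 : Zp]/(1%:R) residue_nat Fp_nat_mod.
Qed.

HB.instance Definition _ := GRing.isZmodMorphism.Build Zp 'F_p to_Fp to_Fp_is_zmod.
HB.instance Definition _ := GRing.isMonoidMorphism.Build Zp 'F_p to_Fp to_Fp_is_monoid.

Lemma to_Fp_eq0 x : to_Fp x = 0 <-> pow_dvd p%:R 1 x.
Proof.
apply: (iff_trans _ (residue_eq0 1 x)).
have := residue_lt x 1; rewrite /to_Fp expn1 => xp; split=> [|->//].
by move/(congr1 val); rewrite /= val_Fp_nat // modn_small.
Qed.

Lemma to_Fp_unit x : (x \is a GRing.unit) = (to_Fp x != 0).
Proof.
apply/idP/idP => [/(rmorph_unit to_Fp)|]; first by rewrite unitfE.
move=> x0; apply/padic_unitP; rewrite -[p%:R]expr1 => /to_Fp_eq0 e.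
by rewrite e eqxx in x0.
Qed.

(** At [v * p%:R] its value is, up to sign, the ratio of the values of Gamma_p at u + v p + p and u
    + v p: shifting [u] by a multiple of p does not change which factors are units. *)
Definition unit_poly (u : Zp) : {poly Zp} :=
  \prod_(j < p | u + j%:R \is a GRing.unit) ('X + (u + j%:R)%:P).

Lemma unit_polyE u v : \prod_(j < p) unit_factor (u + v * p%:R + j%:R) =
  (unit_poly u).[v * p%:R].
Proof.
rewrite /unit_poly horner_prod [RHS]big_mkcond; apply: eq_bigr => j _ /=.
rewrite /unit_factor addrAC padic_unitDp; case: ifP => // _.
by rewrite hornerD hornerX hornerC addrC.
Qed.

(** As j runs below p, -(u + j) runs once through F_p, so the product is that of X - c over all
    nonzero c. *)
Lemma map_unit_poly u : map_poly to_Fp (unit_poly u) = 'X^(p.-1) - 1.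
Proof.
have p1 := prime_gt1 p_pr.
have inj : injective (fun j : 'I_p => - (to_Fp u + j%:R)).
  move=> i j /oppr_inj/addrI/(congr1 val); rewrite /= !val_Fp_nat // !modn_small //.
  exact: val_inj.
have bij : bijective (fun j : 'I_p => - (to_Fp u + j%:R)).
  by apply: inj_card_bij inj _; rewrite card_Fp ?card_ord.
have -> : map_poly to_Fp (unit_poly u) = \prod_(c : 'F_p | c != 0) ('X - c%:P).
  rewrite rmorph_prod /= (reindex _ (onW_bij _ bij)) /=.
  apply: eq_big => [j|j _]; first by rewrite to_Fp_unit rmorphD rmorph_nat oppr_eq0.
  by rewrite rmorphD /= map_polyX map_polyC /= rmorphD rmorph_nat polyCN opprK.
apply: (@mulfI _ 'X); first by rewrite polyX_eq0.
rewrite mulrBr mulr1 -exprS prednK ?prime_gt0 //.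
have := finField_genPoly 'F_p; rewrite card_Fp // => ->.
by rewrite [RHS](bigD1 0) //= subr0.
Qed.

Lemma unit_poly_coef u i : pow_dvd p%:R 1 ((unit_poly u)`_i - ('X^(p.-1) - 1)`_i).
Proof.
apply/to_Fp_eq0; rewrite rmorphB -!(coef_map to_Fp) map_unit_poly.
have -> : map_poly to_Fp ('X^(p.-1) - 1) = 'X^(p.-1) - 1.
  by rewrite rmorphB rmorph1 /= map_polyXn.
by rewrite subrr.
Qed.

End Gamma.

(** * Functional equation and second-order Taylor expansion of Gamma_p *)

Section OddGamma.
Variables (p : nat) (p_pr : prime p) (p_odd : odd p).
Notation Zp := (padic_int p_pr).
Notation Gam := (@morita_gamma p p_pr).

Lemma odd_prime_ge3 : (2 < p)%N.
Proof. by rewrite odd_prime_gt2. Qed.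

(** Continuity alone gives no explicit modulus. The periodicity of [morita_nat] does: modulo p^k,
    Gamma_p depends only on the argument modulo p^k. *)
Lemma residue_gamma (x : Zp) k :
  residue (Gam x) k = residue (morita_nat p_pr (residue x k)) k.
Proof.
have [G0 Gn Gc] := morita_gammaP p_pr p_odd.
have {}Gn n : Gam n%:R = morita_nat p_pr n.
  by case: n => [|n]; [rewrite [LHS]G0 /morita_nat big_geq // mulr1|rewrite Gn].
have [m hm] := Gc x k.
have /hm/padic_eqmodP <- : padic_eqmod m (residue x (maxn m k))%:R x.
  by apply/padic_eqmodP; rewrite residue_nat residueP // leq_maxl.
rewrite Gn; apply: morita_nat_periodic => //.
by rewrite residue_mod residueP // leq_maxr.
Qed.

Lemma gamma_eqmod (x y : Zp) k : pow_dvd p%:R k (x - y) ->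
  pow_dvd p%:R k (Gam x - Gam y).
Proof.
move=> xy; have /padic_eqmodP e : padic_eqmod k x y by [].
have /padic_eqmodP : residue (Gam x) k = residue (Gam y) k by rewrite !residue_gamma e.
by [].
Qed.

Lemma gammaS (x : Zp) : Gam (x + 1) = - unit_factor x * Gam x.
Proof.
apply: padic_ext => -[|k]; first by rewrite expn0 !modn1.
(* A natural number close to [x]; adding p^(k+1) makes it positive, as the product formula for
   Gamma_p requires. *)
congr (_ %% _)%N; set n := (residue x k.+1 + p ^ k.+1)%N.
have n0 : (0 < n)%N by rewrite addn_gt0 expn_gt0 (prime_gt0 p_pr) orbT.
have nx : pow_dvd p%:R k.+1 (x - n%:R).
  have : padic_eqmod k.+1 x n%:R.
    by apply/padic_eqmodP; rewrite residue_nat modnDr residue_mod.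
  by [].
have nx1 : pow_dvd p%:R k.+1 (x + 1 - n.+1%:R).
  by rewrite -natr1 opprD addrACA subrr addr0.
have [_ Gn _] := morita_gammaP p_pr p_odd.
have GS : Gam n.+1%:R = - unit_factor n%:R * Gam n%:R.
  rewrite !Gn // /morita_nat big_mkcond big_nat_recr //= -big_mkcond /= exprS.
  by rewrite /unit_factor padic_unit_nat; case: ifP => _; ring.
apply/padic_eqmodP; rewrite /padic_eqmod.
have uxn : pow_dvd p%:R k.+1 (unit_factor x - unit_factor n%:R).
  rewrite /unit_factor (@padic_unitD _ _ x n%:R); last exact: pow_dvdW nx.
  by case: ifP => // _; rewrite subrr; apply: pow_dvd0.
have -> : Gam (x + 1) - - unit_factor x * Gam x =
    (Gam (x + 1) - Gam n.+1%:R) + (Gam n%:R * (unit_factor x - unit_factor n%:R)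
      + unit_factor x * (Gam x - Gam n%:R)) by rewrite GS; ring.
apply: pow_dvdD; first exact: gamma_eqmod.
by apply: pow_dvdD; apply: pow_dvdMl => //; apply: gamma_eqmod.
Qed.

Lemma gammaDn (x : Zp) n :
  Gam (x + n%:R) = (-1) ^+ n * (\prod_(j < n) unit_factor (x + j%:R)) * Gam x.
Proof.
elim: n => [|n IH]; first by rewrite addr0 big_ord0 !mul1r.
by rewrite -natr1 addrA gammaS IH big_ord_recr exprS /=; ring.
Qed.

Lemma gamma0 : Gam 0 = 1. Proof. by have [] := morita_gammaP p_pr p_odd. Qed.

Lemma gamma1 : Gam 1 = -1.
Proof.
rewrite -{1}[1]add0r gammaS gamma0 mulr1 /unit_factor padic_unitE.
by rewrite (residue_nat p_pr 0) mod0n dvdn0.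
Qed.

Lemma gamma_unit (x : Zp) : Gam x \is a GRing.unit.
Proof.
have xn : pow_dvd p%:R 1 (x - (residue x 1)%:R).
  have : padic_eqmod 1 x (residue x 1)%:R.
    by apply/padic_eqmodP; rewrite residue_nat residue_mod.
  by [].
rewrite (padic_unitD (gamma_eqmod xn)) -[_%:R]add0r gammaDn gamma0 mulr1 unitrM.
rewrite unitrX ?unitrN1 //=.
elim/big_rec: _ => [|i y _ uy]; first exact: unitr1.
by rewrite unitrM unit_factor_unit.
Qed.

(* Precision of the Taylor expansion of Gamma_p on p Z_p; it is not 3 when
   p = 3, because the polynomial 'X^(p.-1) - 1 then has degree 2, but precision 2
   is enough in that case since dixon_corr_value is then a multiple of p. *)
Definition gamma_prec : nat := ((3 < p) + 2)%N.

Lemma gamma_prec_le3 : (gamma_prec <= 3)%N.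
Proof. by rewrite /gamma_prec; case: (3 < p)%N. Qed.

(** Modulo p the polynomial is X^(p-1) - 1, so its constant coefficient is -1 plus a multiple of p
    and its linear one is a multiple of p. The quadratic one is a multiple of p only for p > 3,
    which is where [gamma_prec] enters. *)
Lemma unit_poly_taylor (u : Zp) : exists k0 k1, forall v,
  pow_dvd p%:R gamma_prec
    (- (unit_poly u).[v * p%:R] - (1 + k0 * p%:R + k1 * v * p%:R ^+ 2)).
Proof.
have p2 := odd_prime_ge3; set H := unit_poly u.
have [z0 e0] := unit_poly_coef u 0; have [z1 e1] := unit_poly_coef u 1.
have [z2 e2] := unit_poly_coef u 2; rewrite -/H in e0 e1 e2.
move: e0 e1 e2; rewrite !coefB !coefXn !coef1 /= expr1.
have -> : (0 == p.-1)%N = false by lia.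
have -> : (1 == p.-1)%N = false by lia.
rewrite sub0r opprK subr0 subr0 => e0 e1 e2.
exists (- z0), (- z1) => v.
have HE : H.[v * p%:R] = H`_0 + H`_1 * (v * p%:R) + H`_2 * (v * p%:R) ^+ 2
    + (drop_poly 3 H).[v * p%:R] * (v * p%:R) ^+ 3.
  rewrite -{1}(poly_take_drop 3 H) hornerD hornerM hornerXn horner_poly.
  by rewrite !big_ord_recl big_ord0 /= /bump /=; ring.
have {e0} e0 : H`_0 = z0 * p%:R - 1 by rewrite -e0 addrK.
rewrite HE e0 e1.
have -> : - (z0 * p%:R - 1 + z1 * p%:R * (v * p%:R) + H`_2 * (v * p%:R) ^+ 2 +
      (drop_poly 3 H).[v * p%:R] * (v * p%:R) ^+ 3) -
      (1 + - z0 * p%:R + - z1 * v * p%:R ^+ 2) =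
   - v ^+ 2 * (H`_2 * p%:R ^+ 2) + (- (drop_poly 3 H).[v * p%:R] * v ^+ 3) * p%:R ^+ 3.
  by ring.
apply: pow_dvdD; last first.
  by apply: pow_dvdMl; apply: pow_dvdW gamma_prec_le3 _; exists 1; rewrite mul1r.
apply: pow_dvdMl; rewrite /gamma_prec; case: ltnP => p3 /=; last by exists (H`_2).
exists z2; move: e2; have -> : (2 == p.-1)%N = false by lia.
by rewrite !subr0 => ->; ring.
Qed.

Lemma two_unit : (2%:R : Zp) \is a GRing.unit.
Proof.
rewrite padic_unit_nat; apply/negP => /dvdn_leq; have := odd_prime_ge3; lia.
Qed.

Definition onehalf : Zp := 1 / 2%:R.

Lemma onehalfK : onehalf * 2%:R = 1. Proof. by rewrite /onehalf divrK // two_unit. Qed.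

(** Along u + n p with n natural, [unit_poly_taylor] makes this a recurrence in n, solved by a
    quadratic polynomial; density of the naturals then gives all v. *)
Lemma gamma_taylor (u : Zp) : exists A B, forall v, pow_dvd p%:R gamma_prec
  (Gam (u + v * p%:R) - Gam u * (1 + A * (v * p%:R) + B * (v * p%:R) ^+ 2)).
Proof.
have [k0 [k1 hk]] := unit_poly_taylor u.
(* Multiplying the expansion at n by 1 + k0 p + k1 n p^2 has to give the one at n + 1. Modulo p^3
   this requires A + p B = k0 and 2 B = k1 + k0^2, from the terms of degree 0 and 1 in n. *)
pose B := onehalf * (k1 + k0 ^+ 2); pose A := k0 - p%:R * B.
have k1E : k1 = B * 2%:R - k0 ^+ 2 by rewrite /B mulrAC onehalfK mul1r addrK.
exists A, B.
have hn (n : nat) : pow_dvd p%:R gamma_prec (Gam (u + n%:R * p%:R) -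
    Gam u * (1 + A * (n%:R * p%:R) + B * (n%:R * p%:R) ^+ 2)).
  elim: n => [|n IH].
    rewrite [X in pow_dvd _ _ X](_ : _ = 0); first exact: pow_dvd0.
    by rewrite !mul0r addr0; ring.
  have -> : u + n.+1%:R * p%:R = u + n%:R * p%:R + p%:R by rewrite -natr1; ring.
  rewrite gammaDn unit_polyE -signr_odd p_odd expr1 mulN1r.
  set h := - _; set g := Gam (u + _) in IH *.
  set r := Gam u * _ in IH.
  have -> : h * g - Gam u * (1 + A * (n.+1%:R * p%:R) + B * (n.+1%:R * p%:R) ^+ 2) =
      h * (g - r) + r * (h - (1 + k0 * p%:R + k1 * n%:R * p%:R ^+ 2))
      + (Gam u * (B * k0 * (n%:R ^+ 2 - n%:R) + k1 * n%:R ^+ 2 * (k0 - p%:R * B)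
           + p%:R * k1 * B * n%:R ^+ 3)) * p%:R ^+ 3.
    by rewrite /r -natr1 k1E /A; ring.
  apply: pow_dvdD; last first.
    by apply: pow_dvdMl; apply: pow_dvdW gamma_prec_le3 _; exists 1; rewrite mul1r.
  by apply: pow_dvdD; apply: pow_dvdMl => //; apply: hk.
(* Replacing [v] by its residue [n] changes the value of Gamma_p and the quadratic polynomial only
   by multiples of p^[gamma_prec]. *)
move=> v; set n := residue v gamma_prec.
have [w vE] : pow_dvd p%:R gamma_prec (v - n%:R).
  have : padic_eqmod gamma_prec v n%:R.
    by apply/padic_eqmodP; rewrite residue_nat residue_mod.
  by [].
have {}vE : v = n%:R + w * p%:R ^+ gamma_prec by rewrite -vE addrC subrK.
set P := p%:R ^+ _ in vE.
have -> : Gam (u + v * p%:R) - Gam u * (1 + A * (v * p%:R) + B * (v * p%:R) ^+ 2) =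
  (Gam (u + v * p%:R) - Gam (u + n%:R * p%:R)) +
  (Gam (u + n%:R * p%:R) - Gam u * (1 + A * (n%:R * p%:R) + B * (n%:R * p%:R) ^+ 2))
  - (Gam u * (A * p%:R * w + B * p%:R ^+ 2 * w * (2%:R * n%:R + w * P))) * P.
  by rewrite vE; ring.
apply: pow_dvdD; last by rewrite -mulNr; apply: pow_dvdMl; exists 1; rewrite mul1r.
apply: pow_dvdD => //; apply: gamma_eqmod; exists (w * p%:R).
by rewrite vE -/P; ring.
Qed.

(** The Taylor polynomial in [v] is smooth by sums and products, and the remainder is a multiple of
    p^[gamma_prec]. *)
Lemma smooth_gamma n (u : Zp) v : smooth p%:R n gamma_prec v ->
  (forall s, pow_dvd p%:R 1 (v s)) ->
  smooth p%:R n gamma_prec (fun s => Gam (u + v s)).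
Proof.
move=> sv vp; have [A [B h]] := gamma_taylor u.
apply: (@smooth_ext _ _ _ _ (fun s => Gam u * (1 + A * v s + B * (v s * v s)) +
  (Gam (u + v s) - Gam u * (1 + A * v s + B * (v s * v s))))) => [s|].
  by rewrite addrC subrK.
apply: smoothD.
  apply: smoothM; first exact: smooth_cst.
  apply: smoothD; [apply: smoothD; first exact: smooth_cst|].
    by apply: smoothM => //; exact: smooth_cst.
  by apply: smoothM; [exact: smooth_cst|exact: smoothM].
apply: smooth_of_dvd => s; have [z ->] := vp s; rewrite expr1.
exact: h.
Qed.

Lemma smooth_gammaV n (u : Zp) v : smooth p%:R n gamma_prec v ->
  (forall s, pow_dvd p%:R 1 (v s)) ->
  smooth p%:R n gamma_prec (fun s => (Gam (u + v s))^-1).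
Proof.
move=> sv vp; apply: (@smoothV _ _ _ _ _ (Gam u) gamma_prec_le3) => [|s|s|].
- exact: gamma_unit.
- exact: gamma_unit.
- by apply: gamma_eqmod; have [z ->] := vp s; exists z; rewrite addrAC subrr add0r.
- exact: smooth_gamma.
Qed.

End OddGamma.

(** * The p-adic analogue of Dixon's product, and iteration of the relation *)

Section Dixon.
Variables (p : nat) (p_pr : prime p) (p_odd : odd p).
Notation Zp := (padic_int p_pr).
Notation Gam := (@morita_gamma p p_pr).
Notation onehalf := (onehalf p_pr).
Implicit Types A B C : Zp.

(** The right side of Dixon's theorem for the well-poised 3F2 at 1, with Gamma_p in place of
    Gamma. *)
Definition dixon_gamma A B C : Zp :=
  Gam (1 + onehalf * A) * Gam (1 + A - B) * Gam (1 + A - C) *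
    Gam (1 + onehalf * A - B - C) /
  (Gam (1 + A) * Gam (1 + onehalf * A - B) * Gam (1 + onehalf * A - C) *
    Gam (1 + A - B - C)).

Lemma dixon_gammaC A B C : dixon_gamma A B C = dixon_gamma A C B.
Proof.
rewrite /dixon_gamma (addrAC _ (- B)) (addrAC (1 + A) (- B)).
by congr (_ / _); ring.
Qed.

Lemma dixon_gamma_unit A B C : dixon_gamma A B C \is a GRing.unit.
Proof. by rewrite unitrM unitrV !unitrM !gamma_unit. Qed.

Lemma dixon_gammal0 B C : dixon_gamma 0 B C = 1.
Proof.
rewrite /dixon_gamma mulr0 !addr0; set D := (X in _ / X).
by rewrite -[X in X / _]/D divrr // !unitrM !gamma_unit.
Qed.

Lemma dixon_gammar0 A B : dixon_gamma A B 0 = 1.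
Proof.
rewrite /dixon_gamma !subr0 [X in X / _](_ : _ = Gam (1 + A) * Gam (1 + onehalf * A - B)
  * Gam (1 + onehalf * A) * Gam (1 + A - B)); last by ring.
by rewrite divrr // !unitrM !gamma_unit.
Qed.

(** The shift moves 1+A by 2, the arguments 1+A/2, 1+A-B, 1+A-C by 1 and 1+A/2-B-C by -1, and fixes
    the other three. The signs from [gammaS] cancel. *)
Lemma dixon_gamma_contiguous A B C :
  dixon_gamma A B C *
    (unit_factor (1 + onehalf * A) * unit_factor (1 + A - B) * unit_factor (1 + A - C)) =
  unit_factor (1 + A) * unit_factor (2%:R + A) * unit_factor (onehalf * A - B - C) *
    dixon_gamma (A + 2%:R) (B + 1) (C + 1).
Proof.
rewrite /dixon_gamma.
have h2 := onehalfK p_pr p_odd.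
have -> : 1 + onehalf * (A + 2%:R) = 1 + onehalf * A + 1 by rewrite mulrDr h2 addrA.
have -> : 1 + (A + 2%:R) - (B + 1) = 1 + A - B + 1 by ring.
have -> : 1 + (A + 2%:R) - (C + 1) = 1 + A - C + 1 by ring.
have -> : 1 + onehalf * A + 1 - (B + 1) = 1 + onehalf * A - B by ring.
have -> : 1 + onehalf * A + 1 - (C + 1) = 1 + onehalf * A - C by ring.
have -> : 1 + onehalf * A - B - (C + 1) = onehalf * A - B - C by ring.
have -> : 1 + A - B + 1 - (C + 1) = 1 + A - B - C by ring.
have -> : 1 + (A + 2%:R) = 1 + A + 1 + 1 by ring.
have -> : 1 + onehalf * A - B - C = onehalf * A - B - C + 1 by ring.
rewrite !gammaS //.
have -> : 1 + A + 1 = 2%:R + A by ring.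
set a := unit_factor (1 + A); set b := unit_factor (2%:R + A).
set D := (X in _ / X * _ = _).
have -> : - b * (- a * Gam (1 + A)) * Gam (1 + onehalf * A - B) *
  Gam (1 + onehalf * A - C) * Gam (1 + A - B - C) = D * (a * b) by rewrite /D; ring.
have uD : D \is a GRing.unit by rewrite !unitrM !gamma_unit.
have uab : a * b \is a GRing.unit by rewrite unitrM !unit_factor_unit.
apply: (mulIr uD); rewrite mulrAC divrK //; rewrite -[RHS]mulrA (invrM uD uab).
rewrite -!mulrA (mulVr uD) mulr1.
apply: (mulIr uab); rewrite -!mulrA (mulVr uab) mulr1.
by ring.
Qed.

Definition nonunit_factor (x : Zp) : Zp := if x \is a GRing.unit then 1 else x.

Lemma nonunit_factorM x : nonunit_factor x * unit_factor x = x.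
Proof.
by rewrite /nonunit_factor /unit_factor; case: ifP; rewrite ?mul1r ?mulr1.
Qed.

(** What [dixon_factor] contains beyond the ratio of Gamma_p products: the nonunits that Gamma_p
    skips. A factor 2 comes from A-2B-2C = 2(A/2-B-C); it cancels against 2+A = 2(1+A/2) exactly
    when 2+A is a unit. *)
Definition dixon_corr A B C : Zp :=
  nonunit_factor (1 + A) * (if 2%:R + A \is a GRing.unit then 1 else 2%:R) *
    nonunit_factor (onehalf * A - B - C).

Lemma dixon_factorE A B C :
  1 + A - B \is a GRing.unit -> 1 + A - C \is a GRing.unit ->
  dixon_factor A B C * dixon_gamma (A + 2%:R) (B + 1) (C + 1) =
  dixon_corr A B C * dixon_gamma A B C.
Proof.
move=> uB uC; set g' := dixon_gamma (A + _) _ _; have h2 := onehalfK p_pr p_odd.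
have uBC : (1 + A - B) * (1 + A - C) \is a GRing.unit by rewrite unitrM uB uC.
have uK := unit_factor_unit (1 + onehalf * A).
have A2 : A = 2%:R * (onehalf * A) by rewrite mulrA (mulrC 2%:R) h2 mul1r.
apply: (mulIr uBC); apply: (mulIr uK).
have := dixon_gamma_contiguous A B C.
rewrite {2 3}/unit_factor uB uC -/g' => rec.
have -> : dixon_corr A B C * dixon_gamma A B C * ((1 + A - B) * (1 + A - C)) *
    unit_factor (1 + onehalf * A) = dixon_corr A B C * (dixon_gamma A B C *
    (unit_factor (1 + onehalf * A) * (1 + A - B) * (1 + A - C))) by ring.
rewrite rec -!(mulrA (dixon_factor A B C)) -(mulrA g') /dixon_factor.
have -> : (1 + A) * (A - 2%:R * B - 2%:R * C) / ((1 + A - B) * (1 + A - C)) *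
    (g' * ((1 + A - B) * (1 + A - C) * unit_factor (1 + onehalf * A))) =
    (1 + A) * (A - 2%:R * B - 2%:R * C) * g' * unit_factor (1 + onehalf * A).
  have clear (x y z w : Zp) : w \is a GRing.unit -> x / w * (y * (w * z)) = x * y * z.
    by move=> uw; rewrite (mulrCA y) [LHS]mulrA divrK // mulrA.
  exact: clear.
have -> : A - 2%:R * B - 2%:R * C = 2%:R * (onehalf * A - B - C).
  by rewrite {1}A2; ring.
rewrite -{1}(nonunit_factorM (1 + A)) /dixon_corr.
have -> : 2%:R + A = 2%:R * (1 + onehalf * A) by rewrite {1}A2; ring.
set K := 1 + onehalf * A; set W := onehalf * A - B - C.
suff e : 2%:R * W * unit_factor K = (if 2%:R * K \is a GRing.unit then 1 else 2%:R) *
    unit_factor (2%:R * K) * W.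
  rewrite -{2}(nonunit_factorM W) in e.
  transitivity (nonunit_factor (1 + A) * unit_factor (1 + A) * g' *
    (2%:R * W * unit_factor K)); first by ring.
  by rewrite e; set c := (if _ then _ else _); ring.
rewrite /unit_factor unitrM (two_unit p_pr p_odd) /=; case: ifP => _; ring.
Qed.

(* The last hypothesis kills the boundary term of dixon_contiguous at the j-th
   step. *)
Lemma dixon_sum_iter M L A B C :
  (forall i, (0 < i <= M + L)%N -> [/\ i%:R \is a @GRing.unit Zp,
     A - B + i%:R \is a GRing.unit & A - C + i%:R \is a GRing.unit]) ->
  (forall j, (j < M)%N -> pochhammer (A + 2%:R * j%:R + 1) (M + L - j) *
     pochhammer (C + j%:R + 1) (M + L - j) = 0) ->
  dixon_sum (M + L).+1 A B C *
    dixon_gamma (A + 2%:R * M%:R) (B + M%:R) (C + M%:R) =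
  (\prod_(j < M) dixon_corr (A + 2%:R * j%:R) (B + j%:R) (C + j%:R)) *
    dixon_gamma A B C * dixon_sum L.+1 (A + 2%:R * M%:R) (B + M%:R) (C + M%:R).
Proof.
elim: M A B C => [|M IH] A B C hu h0.
  by rewrite big_ord0 mulr0 !addr0 mul1r mulrC.
have e2 j : A + 2%:R + 2%:R * j%:R = A + 2%:R * j.+1%:R by rewrite -natr1; ring.
have e1 D j : D + 1 + j%:R = D + j.+1%:R :> Zp by rewrite -natr1; ring.
rewrite addSn dixon_contiguous //.
rewrite [X in _ + X](_ : _ = 0) ?addr0; last first.
  have := h0 0%N isT; rewrite mulr0 !addr0 subn0 addSn => z.
  by rewrite (mulrAC (pochhammer _ _)) z !mul0r.
have := IH (A + 2%:R) (B + 1) (C + 1).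
rewrite !e2 !e1 => IH'; rewrite -(mulrA (dixon_factor A B C)) IH'; first last.
- move=> j jM; have := h0 j.+1 jM; rewrite addSn subSS.
  by rewrite e2 e1.
- move=> i /andP[i0 iM]; have [_ uB uC] := hu i.+1 ltac:(lia).
  split; first by case: (hu i ltac:(lia)).
  + by rewrite [X in X \is a _](_ : _ = A - B + i.+1%:R) // -natr1; ring.
  + by rewrite [X in X \is a _](_ : _ = A - C + i.+1%:R) // -natr1; ring.
have [_ uB uC] := hu 1%N isT.
have fE : dixon_factor A B C * dixon_gamma (A + 2%:R) (B + 1) (C + 1) =
    dixon_corr A B C * dixon_gamma A B C.
  by apply: dixon_factorE; rewrite -addrA addrC.
set g := dixon_gamma _ _ _ in fE *; set S := dixon_sum _ _ _ _.
rewrite [LHS](_ : _ = dixon_factor A B C * g *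
  \prod_(j < M) dixon_corr (A + 2%:R * j.+1%:R) (B + j.+1%:R) (C + j.+1%:R) * S).
  by rewrite fE big_ord_recl mulr0 !addr0 /=; ring.
rewrite (eq_bigr (fun j : 'I_M =>
  dixon_corr (A + 2%:R * j.+1%:R) (B + j.+1%:R) (C + j.+1%:R))) => [|j _].
  by ring.
by rewrite e2 !e1.
Qed.

Lemma dixon_sum_trunc n N A B C : (n <= N)%N ->
  (forall k, (n <= k)%N -> dixon_term A B C k = 0) ->
  dixon_sum N A B C = dixon_sum n A B C.
Proof.
move=> nN h; rewrite /dixon_sum -!(big_mkord xpredT (dixon_term A B C)).
rewrite (big_cat_nat (n := n)) //=.
rewrite [X in _ + X]big_nat [X in _ + X]big1 ?addr0 // => k /andP[nk _].
exact: h.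
Qed.

Lemma dixon_sum1 A B C : dixon_sum 1 A B C = 1.
Proof. by rewrite /dixon_sum big_ord1 dixon_term0. Qed.

Lemma dixon_suml0 N B C : dixon_sum N.+1 0 B C = 1.
Proof.
rewrite (@dixon_sum_trunc 1) ?dixon_sum1 // => k k0.
rewrite /dixon_term; have -> : pochhammer (0 : Zp) k = 0.
  by apply: (@pochhammer_eq0 _ _ 0) => //; rewrite addr0.
by rewrite !mul0r.
Qed.

End Dixon.

(** * Exact evaluation of the terminating sums *)

Section Exact.
Variables (p : nat) (p_pr : prime p) (p_odd : odd p).
Notation Zp := (padic_int p_pr).
Notation onehalf := (onehalf p_pr).
Implicit Types x y z : Zp.

Lemma padic_unit_sub m n (v : Zp) : (n <= m)%N ->
  (m%:R - n%:R + v * p%:R \is a GRing.unit) = ~~ (p %| m - n)%N.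
Proof. by move=> nm; rewrite padic_unitDp -natrB // padic_unit_nat. Qed.

Lemma padic_unit_sub_lt m n (v : Zp) : (m < n + p)%N -> (n < m + p)%N ->
  (m%:R - n%:R + v * p%:R \is a GRing.unit) = (m != n).
Proof.
move=> mn nm; case: (ltngtP m n) => [lt|lt|->]; last first.
- by rewrite padic_unit_sub // subnn dvdn0.
- by rewrite padic_unit_sub 1?ltnW // gtnNdvd //; lia.
rewrite -unitrN opprD opprB -mulNr padic_unit_sub 1?ltnW //.
by rewrite gtnNdvd //; lia.
Qed.

Variables (a : nat) (a0 : (0 < a)%N) (ap : (a < p)%N).

(* The multiple of p met by 3 a - 2 j in the relevant range is this number
   times p. *)
Definition carry : nat := if odd a then 1 else 2.

Definition dixon_corr_value x y z : Zp :=
  (if odd a then x * p%:R else 2%:R) *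
  (if (carry * p <= 3 * a)%N then
     onehalf * ((carry%:R + x - 2%:R * y - 2%:R * z) * p%:R) else 1).

Lemma prod_if_eq M j0 (c : Zp) (F : 'I_M -> Zp) : (j0 < M)%N ->
  (forall j, F j = if j == j0 :> nat then c else 1) -> \prod_(j < M) F j = c.
Proof.
move=> jM FE; rewrite (bigD1 (Ordinal jM)) //= FE eqxx.
rewrite big1 ?mulr1 // => j nj; rewrite FE.
by case: eqP => // e; case/eqP: nj; apply: val_inj.
Qed.

(** Each of the three kinds of factor is nontrivial for at most one j: 1+2j-a meets a multiple of p
    only at 0 with a odd, 2+2j-a only at 0 with a even, and 3a-2j only at [carry * p]. For even a,
    both a/2 and a steps are used in [dixon_exact], hence the range of [M]. *)
Lemma prod_dixon_corr M x y z : (if odd a then M == a else (a./2 <= M <= a))%N ->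
  \prod_(j < M) dixon_corr (- a%:R + x * p%:R + 2%:R * j%:R)
     (- a%:R + y * p%:R + j%:R) (- a%:R + z * p%:R + j%:R) =
  dixon_corr_value x y z.
Proof.
move=> hM; rewrite /dixon_corr !big_split /= /dixon_corr_value; congr (_ * _).
  case: ifP hM => [odda /eqP->|evena hM].
    rewrite [X in _ * X]big1 ?mulr1 => [|j _].
      apply: (@prod_if_eq _ a./2) => [|j]; first by lia.
      have ja := ltn_ord j.
      rewrite /nonunit_factor.
      have -> : 1 + (- a%:R + x * p%:R + 2%:R * j%:R) = (1 + 2 * j)%:R - a%:R + x * p%:R.
        by rewrite natrD natrM; ring.
      rewrite padic_unit_sub_lt; try lia.
      have -> : (1 + 2 * j != a)%N = (j != a./2 :> nat) by lia.
      case: eqP => //= ->.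
      by rewrite (_ : 1 + 2 * a./2 = a)%N ?subrr ?add0r //; lia.
    have -> : 2%:R + (- a%:R + x * p%:R + 2%:R * j%:R) = (2 + 2 * j)%:R - a%:R + x * p%:R.
      by rewrite natrD natrM; ring.
    have ja := ltn_ord j; rewrite padic_unit_sub_lt; try lia.
    by case: eqP => //; lia.
  rewrite [X in X * _]big1 ?mul1r => [|j _].
    apply: (@prod_if_eq _ a./2.-1) => [|j]; first by lia.
    have ja := ltn_ord j.
    have -> : 2%:R + (- a%:R + x * p%:R + 2%:R * j%:R) = (2 + 2 * j)%:R - a%:R + x * p%:R.
      by rewrite natrD natrM; ring.
    rewrite padic_unit_sub_lt; try lia.
    have -> : (2 + 2 * j != a)%N = (j != a./2.-1 :> nat) by lia.
    by case: eqP.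
  have -> : 1 + (- a%:R + x * p%:R + 2%:R * j%:R) = (1 + 2 * j)%:R - a%:R + x * p%:R.
    by rewrite natrD natrM; ring.
  have ja := ltn_ord j; rewrite /nonunit_factor padic_unit_sub_lt; try lia.
  by case: eqP => //; lia.
(* Twice the third argument of [dixon_corr], as an integer plus a multiple of p. *)
pose W j : Zp := (3 * a)%:R - (2 * j)%:R + (x - 2%:R * y - 2%:R * z) * p%:R.
have WE j : onehalf * (- a%:R + x * p%:R + 2%:R * j%:R) -
    (- a%:R + y * p%:R + j%:R) - (- a%:R + z * p%:R + j%:R) = onehalf * W j.
  have e (v : Zp) : v = onehalf * (2%:R * v) by rewrite mulrA onehalfK ?mul1r.
  by rewrite [in LHS](e (_ + y * _ + _)) [in LHS](e (_ + z * _ + _)) /W !natrM; ring.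
have uW j : (j < a)%N -> (onehalf * W j \is a GRing.unit) =
    ~~ ((carry * p <= 3 * a) && (j == (3 * a - carry * p)./2))%N.
  move=> ja; rewrite unitrM {1}/onehalf unitrM unitr1 unitrV two_unit //=.
  rewrite padic_unit_sub; last by lia.
  congr (~~ _); apply/idP/andP => [/dvdnP[k kE]|[ca /eqP->]].
    (* Since 0 < 3a-2j < 3p, the multiple of p is p or 2p, and the parity of a decides which. *)
    have [k1|[k2|]] : (k = 1 \/ k = 2 \/ 2 < k)%N by nia.
    - by rewrite k1 in kE; rewrite /carry; case: ifP => oa; split; lia.
    - by rewrite k2 in kE; rewrite /carry; case: ifP => oa; split; lia.
    - by nia.
  apply/dvdnP; exists carry; move: ca; rewrite /carry; case: ifP => oa; lia.
case: ifP => [ca|nca]; last first.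
  rewrite big1 // => j _; rewrite WE /nonunit_factor uW ?nca //.
  by have := ltn_ord j; case: ifP hM; lia.
apply: (@prod_if_eq _ (3 * a - carry * p)./2) => [|j].
  by move: ca hM; rewrite /carry; case: ifP; lia.
have ja := ltn_ord j; rewrite WE /nonunit_factor uW; last by case: ifP hM; lia.
rewrite ca /=; case: eqP => //= jE; congr (_ * _); rewrite /W jE -natrB; last by lia.
have -> : (3 * a - 2 * (3 * a - carry * p)./2 = carry * p)%N.
  by move: ca; rewrite /carry; case: ifP; lia.
by rewrite natrM; ring.
Qed.

(* The sum terminates through A for x = 0, B for y = 0 and C for z = 0. *)
Lemma dixon_exact x y z : [\/ x = 0, y = 0 | z = 0] ->
  dixon_sum p (- a%:R + x * p%:R) (- a%:R + y * p%:R) (- a%:R + z * p%:R) =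
  dixon_corr_value x y z *
  dixon_gamma (- a%:R + x * p%:R) (- a%:R + y * p%:R) (- a%:R + z * p%:R).
Proof.
have ea : - a%:R + 0 * p%:R + a%:R = 0 :> Zp by rewrite mul0r addr0 addNr.
have hu v w i : (0 < i <= a)%N -> [/\ i%:R \is a @GRing.unit Zp,
    - a%:R + x * p%:R - (- a%:R + v * p%:R) + i%:R \is a GRing.unit &
    - a%:R + x * p%:R - (- a%:R + w * p%:R) + i%:R \is a GRing.unit].
  move=> /andP[i0 ia]; have ui : i%:R \is a @GRing.unit Zp.
    by rewrite padic_unit_nat gtnNdvd //; lia.
  have u v' : - a%:R + x * p%:R - (- a%:R + v' * p%:R) + i%:R \is a GRing.unit.
    by rewrite [X in X \is a _](_ : _ = i%:R + (x - v') * p%:R) ?padic_unitDp //; ring.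
  by split.
(* Here C = -a: after a steps C has become 0, where [dixon_gamma] is 1 and a single term of the sum
   is left. *)
have last0 y' : dixon_sum p (- a%:R + x * p%:R) (- a%:R + y' * p%:R) (- a%:R + 0 * p%:R) =
    dixon_corr_value x y' 0 *
    dixon_gamma (- a%:R + x * p%:R) (- a%:R + y' * p%:R) (- a%:R + 0 * p%:R).
  rewrite (@dixon_sum_trunc _ _ a.+1) // => [|k ak]; last first.
    by rewrite /dixon_term (pochhammer_eq0 ak ea) mulr0 mul0r.
  have := @dixon_sum_iter _ p_pr p_odd a 0 (- a%:R + x * p%:R) (- a%:R + y' * p%:R)
    (- a%:R + 0 * p%:R); rewrite addn0 ea dixon_gammar0 // mulr1 => -> //.
  - by rewrite dixon_sum1 mulr1 prod_dixon_corr // eqxx; case: ifP => // _; lia.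
  - exact: hu.
  - move=> j ja; rewrite (@pochhammer_eq0 _ (_ + j%:R + 1) (a - j.+1)) ?mulr0 //; first by lia.
    by rewrite natrB // -natr1; ring.
case=> [x0|y0|->]; last exact: last0.
  have Aj j : - a%:R + x * p%:R + 2%:R * j%:R = - a%:R + (2 * j)%:R.
    by rewrite x0 mul0r addr0 natrM.
  (* Here A = -a. The boundary term of step j vanishes through (A+2j+1)_(a-j) as long as 2j+1 <= a,
     which [M <= L.+1] guarantees for every j < M. *)
  have rec M L : (M + L = a)%N -> (M <= L.+1)%N ->
      dixon_sum a.+1 (- a%:R + x * p%:R) (- a%:R + y * p%:R) (- a%:R + z * p%:R) *
      dixon_gamma (- a%:R + (2 * M)%:R) (- a%:R + y * p%:R + M%:R)
        (- a%:R + z * p%:R + M%:R) =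
      (\prod_(j < M) dixon_corr (- a%:R + x * p%:R + 2%:R * j%:R)
        (- a%:R + y * p%:R + j%:R) (- a%:R + z * p%:R + j%:R)) *
      dixon_gamma (- a%:R + x * p%:R) (- a%:R + y * p%:R) (- a%:R + z * p%:R) *
      dixon_sum L.+1 (- a%:R + (2 * M)%:R) (- a%:R + y * p%:R + M%:R)
        (- a%:R + z * p%:R + M%:R).
    move=> MLa ML; rewrite -Aj -{1}MLa dixon_sum_iter // MLa; first exact: hu.
    move=> j jM; rewrite Aj (@pochhammer_eq0 _ _ (a - (2 * j).+1)) ?mul0r //; first by lia.
    by rewrite natrB -?natr1; [ring|lia].
  rewrite (@dixon_sum_trunc _ _ a.+1) // => [|k ak]; last first.
    by rewrite /dixon_term x0 (pochhammer_eq0 ak ea) !mul0r.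
  (* For even a, a/2 steps bring A to 0. For odd a, the last of (a+1)/2 steps has the factor 1+A+2j
     = 0, so the sum vanishes, as does [dixon_corr_value] at x = 0. *)
  case: (boolP (odd a)) => odda; last first.
    have := rec a./2 a./2 ltac:(lia) ltac:(lia).
    rewrite (_ : 2 * a./2 = a)%N; last by lia.
    rewrite addNr dixon_gammal0 // mulr1 dixon_suml0 mulr1 => ->.
    by rewrite prod_dixon_corr // (negPf odda); lia.
  have /(congr1 (fun u => u / dixon_gamma (- a%:R + (2 * a./2.+1)%:R)
    (- a%:R + y * p%:R + a./2.+1%:R) (- a%:R + z * p%:R + a./2.+1%:R))) :=
    rec a./2.+1 a./2 ltac:(lia) ltac:(lia).
  rewrite mulrK ?dixon_gamma_unit // => ->.
  rewrite /dixon_corr_value odda x0 !mul0r big_ord_recr /=.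
  rewrite /dixon_corr /nonunit_factor.
  rewrite [1 + (- a%:R + 0 + _)](_ : _ = 0); last first.
    have e : a = (1 + 2 * a./2)%N by lia.
    by rewrite {1}e natrD natrM; ring.
  by rewrite unitr0 !mul0r mulr0 !mul0r.
rewrite y0 dixon_sumC last0.
rewrite (dixon_gammaC _ _ (- a%:R + z * p%:R)); congr (_ * _).
by rewrite /dixon_corr_value [X in onehalf * (X * _)]addrAC.
Qed.
End Exact.

(** * Smoothness of the sum and of the Gamma_p product *)

Section Smoothness.
Variables (p : nat) (p_pr : prime p) (p_odd : odd p).
Notation Zp := (padic_int p_pr).
Notation Gam := (@morita_gamma p p_pr).
Notation onehalf := (onehalf p_pr).
Notation smooth := (@smooth Zp p%:R 3).
Variable x : nat -> seq bool -> Zp.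
Hypothesis xp : forall i s, pow_dvd p%:R 1 (x i s).

Lemma smooth_pochhammer d f k : smooth d f -> smooth d (fun s => pochhammer (f s) k).
Proof.
move=> sf; apply: smooth_prod => i.
by apply: smoothD => //; apply: smooth_cst.
Qed.

Lemma to_Fp_pochhammer (u : Zp) k : to_Fp (pochhammer u k) = pochhammer (to_Fp u) k.
Proof.
by rewrite rmorph_prod; apply: eq_bigr => i _; rewrite rmorphD rmorph_nat.
Qed.

(** Each term is a quotient of polynomials in the [x i]. As these are multiples of p, the
    denominator is congruent to k!^3 modulo p, a unit for k < p, and [smoothV] applies. *)
Lemma smooth_dixon_sum (b : Zp) : (forall i, smooth 3 (x i)) ->
  smooth 3 (fun s => dixon_sum p (b + x 0 s) (b + x 1 s) (b + x 2 s)).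
Proof.
move=> sx; apply: smooth_sum => k; have kp := ltn_ord k.
have sb i : smooth 3 (fun s => pochhammer (b + x i s) k).
  by apply: smooth_pochhammer; apply: smoothD => //; apply: smooth_cst.
apply: smoothM; first by apply: smoothM => //; apply: smoothM.
have fE s : to_Fp (k`!%:R * pochhammer (1 + (b + x 0 s) - (b + x 1 s)) k *
      pochhammer (1 + (b + x 0 s) - (b + x 2 s)) k) = to_Fp (k`!%:R ^+ 3).
  have e i : to_Fp (1 + (b + x 0 s) - (b + x i s)) = 1.
    rewrite (_ : _ - _ = 1 + (x 0 s - x i s)); last by ring.
    have x0 j : to_Fp (x j s) = 0 by apply/to_Fp_eq0.
    by rewrite rmorphD rmorph1 rmorphB /= !x0 subrr addr0.
  by rewrite !rmorphM /= !to_Fp_pochhammer !e pochhammer1 /= ?rmorphXn /= !rmorph_nat; ring.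
have u3 : (k`!%:R ^+ 3 : Zp) \is a GRing.unit.
  rewrite unitrX // padic_unit_nat.
  have : (k < p)%N by []; elim: (nat_of_ord k) => [|n IH] np.
    by rewrite gtnNdvd // prime_gt1.
  by rewrite factS Euclid_dvdM // negb_or IH ?gtnNdvd //; lia.
apply: (@smoothV _ _ _ _ _ (k`!%:R ^+ 3)) => // [s|s|].
- by rewrite to_Fp_unit fE -to_Fp_unit.
- by apply/to_Fp_eq0; rewrite rmorphB /= fE subrr.
have s1 i : smooth 3 (fun s => pochhammer (1 + (b + x 0 s) - (b + x i s)) k).
  apply: smooth_pochhammer; apply: (@smooth_ext _ _ _ _ (fun s => 1 + (x 0 s + - x i s))).
    by move=> s; ring.
  by apply: smoothD; [apply: smooth_cst|apply: smoothD => //; apply: smoothN].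
by apply: smoothM => //; apply: smoothM => //; apply: smooth_cst.
Qed.

Notation prec := (gamma_prec p).

Lemma smooth_dixon_gamma (b : Zp) : (forall i, smooth prec (x i)) ->
  smooth prec (fun s => dixon_gamma (b + x 0 s) (b + x 1 s) (b + x 2 s)).
Proof.
move=> sx.
(* Every argument of Gamma_p in [dixon_gamma] is a constant plus such a form, which is divisible by
   p. *)
pose lin c0 c1 c2 s : Zp := c0 * x 0 s + c1 * x 1 s + c2 * x 2 s.
have slin c0 c1 c2 : smooth prec (lin c0 c1 c2).
  have sc c i : smooth prec (fun s => c * x i s) by apply: smoothM (smooth_cst _ _ _ _) _.
  by apply: smoothD => //; apply: smoothD.
have plin c0 c1 c2 s : pow_dvd p%:R 1 (lin c0 c1 c2 s).
  by apply: pow_dvdD; [apply: pow_dvdD|]; apply: pow_dvdMl.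
have sG u c0 c1 c2 (f : seq bool -> Zp) : (forall s, f s = u + lin c0 c1 c2 s) ->
    smooth prec (fun s => Gam (f s)).
  move=> fE; apply: (@smooth_ext _ _ _ _ (fun s => Gam (u + lin c0 c1 c2 s))).
    by move=> s; rewrite fE.
  exact: smooth_gamma.
have sGV u c0 c1 c2 (f : seq bool -> Zp) : (forall s, f s = u + lin c0 c1 c2 s) ->
    smooth prec (fun s => (Gam (f s))^-1).
  move=> fE; apply: (@smooth_ext _ _ _ _ (fun s => (Gam (u + lin c0 c1 c2 s))^-1)).
    by move=> s; rewrite fE.
  exact: smooth_gammaV.
have invM4 (g1 g2 g3 g4 : Zp) : g1 \is a GRing.unit -> g2 \is a GRing.unit ->
    g3 \is a GRing.unit -> g4 \is a GRing.unit ->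
    (g1 * g2 * g3 * g4)^-1 = g1^-1 * g2^-1 * g3^-1 * g4^-1.
  move=> u1 u2 u3 u4; rewrite !invrM ?unitrM ?u1 ?u2 ?u3 //.
  by ring.
apply: smoothM; first apply: smoothM; first apply: smoothM; first apply: smoothM.
- by apply: (sG (1 + onehalf * b) onehalf 0 0) => s; rewrite /lin; ring.
- by apply: (sG 1 1 (-1) 0) => s; rewrite /lin; ring.
- by apply: (sG 1 1 0 (-1)) => s; rewrite /lin; ring.
- apply: (sG (1 + onehalf * b - 2%:R * b) onehalf (-1) (-1)) => s.
  by rewrite /lin; ring.
apply: (@smooth_ext _ _ _ _ (fun s => (Gam (1 + (b + x 0 s)))^-1 *
  (Gam (1 + onehalf * (b + x 0 s) - (b + x 1 s)))^-1 *
  (Gam (1 + onehalf * (b + x 0 s) - (b + x 2 s)))^-1 *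
  (Gam (1 + (b + x 0 s) - (b + x 1 s) - (b + x 2 s)))^-1)) => [s|].
  by rewrite invM4 ?gamma_unit.
apply: smoothM; first apply: smoothM; first apply: smoothM.
- by apply: (sGV (1 + b) 1 0 0) => s; rewrite /lin; ring.
- by apply: (sGV (1 + onehalf * b - b) onehalf (-1) 0) => s; rewrite /lin; ring.
- by apply: (sGV (1 + onehalf * b - b) onehalf 0 (-1)) => s; rewrite /lin; ring.
- by apply: (sGV (1 - b) 1 (-1) (-1)) => s; rewrite /lin; ring.
Qed.

End Smoothness.

(** * Passage from seven corners to the eighth *)

Section Supercongruence.
Variables (p : nat) (p_pr : prime p) (p_odd : odd p).
Notation Zp := (padic_int p_pr).
Variables (a : nat) (a0 : (0 < a)%N) (ap : (a < p)%N) (t : Zp).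

Let x i s : Zp := (nth false s i)%:R * t.

(** For p = 3 [dixon_gamma] is known to be smooth only to precision 2; a factor p in the correction
    makes up for the missing power. *)
Lemma mixdvd_corr_gamma :
  mixdvd p%:R 3 (minn^~ 3) (fun s => dixon_corr_value a (x 0 s) (x 1 s) (x 2 s) *
    dixon_gamma (- a%:R + x 0 s * p%:R) (- a%:R + x 1 s * p%:R) (- a%:R + x 2 s * p%:R)).
Proof.
have xw w i : (w 1 <= 1)%N -> mixdvd p%:R 3 w (fun s => x i s * p%:R).
  move=> w1; apply: (@mixdvd_ext _ _ _ _ (fun s => (nth false s i)%:R * (t * p%:R))).
    by move=> s; rewrite mulrA.
  exact: mixdvd_coord.
have sg : smooth p%:R 3 (gamma_prec p) (fun s =>
    dixon_gamma (- a%:R + x 0 s * p%:R) (- a%:R + x 1 s * p%:R) (- a%:R + x 2 s * p%:R)).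
  apply: (@smooth_dixon_gamma _ _ p_odd (fun i s => x i s * p%:R)) => [i s|i].
    by exists (x i s); rewrite expr1.
  by apply: (xw); apply: geq_minl.
(* Weights of a smooth function that is itself divisible by p; a product with a function of weights
   min(l, 2) still reaches min(k+l, 3). *)
pose w k := maxn 1 k.
have wM f g : mixdvd (p%:R : Zp) 3 w f -> mixdvd p%:R 3 w g ->
    mixdvd p%:R 3 w (fun s => f s * g s).
  by apply: mixdvdM => [k l|k l]; rewrite /w; lia.
have wZ c f : mixdvd (p%:R : Zp) 3 w f -> mixdvd p%:R 3 w (fun s => c * f s).
  move=> wf; apply: (@mixdvdM _ _ _ id w) _ wf => [k l|k l|]; rewrite /w; try lia.
  by apply: mixdvd_cst; exists c; rewrite mulr1.
have slin c : mixdvd (p%:R : Zp) 3 w (fun s => onehalf p_pr *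
    ((c + x 0 s - 2%:R * x 1 s - 2%:R * x 2 s) * p%:R)).
  apply: (wZ); apply: (@mixdvd_ext _ _ _ _ (fun s => c * p%:R + x 0 s * p%:R +
     (-2%:R) * (x 1 s * p%:R) + (-2%:R) * (x 2 s * p%:R))) => [s|]; first by ring.
  apply: mixdvdD; last by apply: (wZ); apply: (xw).
  apply: mixdvdD; last by apply: (wZ); apply: (xw).
  apply: mixdvdD; last by apply: (xw).
  by apply: mixdvd_cst; exists c; rewrite expr1.
have finish c : mixdvd (p%:R : Zp) 3 w c -> mixdvd p%:R 3 (minn^~ 3) (fun s => c s *
    dixon_gamma (- a%:R + x 0 s * p%:R) (- a%:R + x 1 s * p%:R) (- a%:R + x 2 s * p%:R)).
  move=> wc; apply: mixdvdM wc sg => [k l|k l]; rewrite /w /gamma_prec; lia.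
rewrite /dixon_corr_value.
case odda: (odd a); case ca: (carry a * p <= 3 * a)%N.
- by apply: finish; apply: wM; [apply: xw|apply: slin].
- apply: finish; apply: (@mixdvd_ext _ _ _ _ (fun s => x 0 s * p%:R)) => [s|].
    by rewrite mulr1.
  exact: xw.
- by apply: finish; apply: wZ.
(* The only case where the correction has no factor p. Here a >= 2 and 3a < 2p exclude p = 3, so the
   precision is already 3. *)
have p3 : (3 < p)%N by move: ca; rewrite /carry odda; lia.
move: sg; rewrite /gamma_prec p3 => sg.
apply: (@smoothM _ _ _ 3 (fun=> _)) sg.
exact: smooth_cst.
Qed.

Lemma dixon_supercongruence : pow_dvd p%:R 3
  (dixon_sum p (- a%:R + t * p%:R) (- a%:R + t * p%:R) (- a%:R + t * p%:R) -
   dixon_corr_value a t t t *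
   dixon_gamma (- a%:R + t * p%:R) (- a%:R + t * p%:R) (- a%:R + t * p%:R)).
Proof.
pose E s := dixon_sum p (- a%:R + x 0 s * p%:R) (- a%:R + x 1 s * p%:R) (- a%:R + x 2 s * p%:R)
  - dixon_corr_value a (x 0 s) (x 1 s) (x 2 s) *
    dixon_gamma (- a%:R + x 0 s * p%:R) (- a%:R + x 1 s * p%:R) (- a%:R + x 2 s * p%:R).
have sE : smooth p%:R 3 3 E.
  apply: smoothD; last exact: smoothN mixdvd_corr_gamma.
  apply: (@smooth_dixon_sum _ _ p_odd (fun i s => x i s * p%:R)) => [i s|i].
    by exists (x i s); rewrite expr1.
  apply: (@mixdvd_ext _ _ _ _ (fun s => (nth false s i)%:R * (t * p%:R))).
    by move=> s; rewrite mulrA.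
  exact: mixdvd_coord.
have := mixdvd_corner sE; rewrite /E /x /= !mul1r; apply.
(* At a corner other than the last, one of the three parameters equals -a and [dixon_exact] makes
   the difference zero. *)
case=> [|b0 [|b1 [|b2 [|? ?]]]] //= _ nt.
rewrite dixon_exact ?subrr //.
case: b0 nt => [|_]; last by apply: Or31; rewrite mul0r.
case: b1 => [|_]; last by apply: Or32; rewrite mul0r.
by case: b2 => // _; apply: Or33; rewrite mul0r.
Qed.

End Supercongruence.

(** * Specialization to A = B = C = alpha and the four cases *)

Lemma rat_lt_third (r c p : nat) : (r%:R < c%:R / 3%:R * p%:R :> rat) = (3 * r < c * p)%N.
Proof. by rewrite mulrAC ltr_pdivlMr // -!natrM ltr_nat mulnC. Qed.

Theorem theorem5p1 (p : nat) (p_pr : prime p) (p_odd : odd p)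
    (alpha : padic_int p_pr) (alpha_unit : alpha \is a GRing.unit) :
  let S : padic_int p_pr :=
    \sum_(0 <= k < p) pochhammer alpha k ^+ 3 / (k`!)%:R ^+ 3 in
  let r : nat := padic_lnr (- alpha) in
  let alpha' : padic_int p_pr := padic_dash alpha in
  [/\ ~~ odd r -> (r%:R < 2%:R / 3%:R * p%:R :> rat) ->
        padic_eqmod 3 S (2%:R * g_p alpha),
      ~~ odd r -> (r%:R >= 2%:R / 3%:R * p%:R :> rat) ->
        padic_eqmod 3 S (p%:R * (2%:R - 3%:R * alpha') * g_p alpha),
      odd r -> (r%:R < 1 / 3%:R * p%:R :> rat) ->
        padic_eqmod 3 S (p%:R * alpha' * g_p alpha)
    & odd r -> (r%:R >= 1 / 3%:R * p%:R :> rat) ->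
        padic_eqmod 3 S
          (1 / 2%:R * p%:R ^+ 2 * alpha' * (1 - 3%:R * alpha') * g_p alpha)].
Proof.
move=> S r t.
have rp : (r < p)%N by have := residue_lt (- alpha) 1; rewrite expn1.
have r0 : (0 < r)%N.
  rewrite lt0n; apply/eqP => r0.
  by move: alpha_unit; rewrite -unitrN padic_unitE -[residue _ 1]/r r0 dvdn0.
have aE : - r%:R + t * p%:R = alpha by rewrite padic_dashE addrC addrK.
have h2 := onehalfK p_pr p_odd.
have SE : S = dixon_sum p alpha alpha alpha.
  rewrite /S big_mkord; apply: eq_bigr => k _; rewrite /dixon_term addrK pochhammer1.
  by congr (_ / _); ring.
(* The two factors Gamma_p(1+A-B) and Gamma_p(1+A-C) become Gamma_p(1) = -1 and cancel; 1 - 3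
   alpha/2 is 1 + alpha/2 - 2 alpha. *)
have gE : g_p alpha = dixon_gamma alpha alpha alpha.
  rewrite /g_p /dixon_gamma addrK gamma1 //.
  have A2 : alpha = 2%:R * (onehalf p_pr * alpha) by rewrite mulrA (mulrC 2%:R) h2 mul1r.
  have -> : 3%:R / 2%:R * alpha = 3%:R * (onehalf p_pr * alpha).
    by rewrite /onehalf mul1r !mulrA.
  rewrite -[1 / 2%:R]/(onehalf p_pr); set h := onehalf p_pr * alpha in A2 *.
  have -> : 1 - 3%:R * h = 1 + h - alpha - alpha by rewrite A2; ring.
  have -> : 1 + h - alpha = 1 - h by rewrite A2; ring.
  by congr (_ / _); ring.
have := dixon_supercongruence p_odd r0 rp t; rewrite aE -SE -gE /dixon_corr_value.
move=> main.
have lt1 := rat_lt_third r 1 p; have lt2 := rat_lt_third r 2 p.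
have double (u : padic_int p_pr) : 2%:R * (onehalf p_pr * u) = u.
  by rewrite mulrA (mulrC 2%:R) h2 mul1r.
(* The parity of r fixes [carry], and the threshold decides whether 3r reaches [carry * p], that is,
   whether the second factor of [dixon_corr_value] is present. *)
split=> odd_r; rewrite ?leNgt ?lt1 ?lt2 => hr; move: main;
  rewrite /carry ?(negPf odd_r) ?odd_r /= => main.
- by move: main; rewrite leqNgt hr mulr1.
- move: main; rewrite leqNgt hr double.
  by have -> : (2%:R + t - 2%:R * t - 2%:R * t) * p%:R = p%:R * (2%:R - 3%:R * t) by ring.
- by move: main; rewrite leqNgt hr mulr1 (mulrC t).
- move: main; rewrite leqNgt hr /=.
  have -> : t * p%:R * (onehalf p_pr * ((1 + t - 2%:R * t - 2%:R * t) * p%:R)) =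
    1 / 2%:R * p%:R ^+ 2 * t * (1 - 3%:R * t) by rewrite /onehalf; ring.
  by [].
Qed.
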